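(* For every $n\ge0$, $|\mathsf{GNC}_n(ud,h)|=R_n$, the $n$th little Schröder number, and $$|\mathsf{GNC}_{n}(du,h)|=\sum_{i+j+k=n}(-1)^k\binom{3i+2j+k}{k}\frac{i}{2j+i}\binom{2j+i}{j}2^{i+j}C_i,$$ the sum over nonnegative integers $i,j,k$, where $C_i=\frac{1}{i+1}\binom{2i}{i}$.
   Context: A non-crossing tree on $n+1$ points: place $n+1$ points $p_0,\dots,p_n$ on a circle in counterclockwise order and draw a tree on them with straight edges inside the circle, no two crossing. A (rooted) GNC-tree with $n+1$ vertices is such a tree with a labelling of the points by positive integers, weakly increasing along $p_0,\dots,p_n$, $p_0$ labelled 1, label set $\{1,\dots,m\}$ for some $m$; rooted at $p_0$. $\mathsf{GNC}_n$ is the set of these. Orient each edge from parent (closer to root) to child; it is an ascent ($u$) if parent label $<$ child label, a level ($h$) if equal, a descent ($d$) if larger. Each root-to-vertex path gives a word over $\{u,h,d\}$; a tree contains $\sigma$ if some such word contains $\sigma$ as a contiguous factor, and avoids $\sigma$ otherwise. $\mathsf{GNC}_n(P)$ is the set of trees in $\mathsf{GNC}_n$ avoiding all words in $P$. The little Schröder numbers $R_n$ have generating function $\sum_n R_nt^n=\frac{1+t-\sqrt{1-6t+t^2}}{4t}$. The factor $\frac{i}{2j+i}\binom{2j+i}{j}$ denotes $[s^j]C(s)^i$ with $C(s)=\sum_m C_ms^m$; in particular for $i=0$ it equals $1$ if $j=0$ and $0$ otherwise. *)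

(* Defs.v *)
From HB Require Import structures.
From mathcomp Require Import all_boot all_order all_algebra.
From mathcomp Require Import ring.

Set Implicit Arguments.
Unset Strict Implicit.
Unset Printing Implicit Defensive.

Import GRing.Theory.

(** * Non-crossing trees

   The point p_i is the ordinal i : 'I_n.+1, and an edge is a two-element set
   of points. *)

Section Graph.
Variable n : nat.
Local Notation point := 'I_n.+1.
Implicit Type E : {set {set point}}.

Definition adj E : rel point := [rel x y | [set x; y] \in E].

Definition simple_graph E := [forall A in E, #|A| == 2].

Definition connected_graph E := [forall x, forall y, connect (adj E) x y].

(* A cycle visits at least three distinct points, and at most n.+1. *)
Definition acyclic_graph E :=
  [forall k : 'I_n.+2, forall c : k.-tuple point,
     (2 < k) ==> ~~ (cycle (adj E) c && uniq c)].

Definition is_tree E :=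
  [&& simple_graph E, connected_graph E & acyclic_graph E].

(* For points in counterclockwise order on a circle, the chords ab and cd meet
   inside the circle exactly when their endpoints are interleaved. *)
Definition noncrossing E :=
  [forall a : point, forall b : point, forall c : point, forall d : point,
     adj E a b && adj E c d ==> ~~ [&& a < c, c < b & b < d]].

End Graph.

(** * GNC-trees *)

(* A label set {1, ..., m} on n.+1 points has m <= n.+1, so labels are taken in
   'I_n.+2 = {0, ..., n.+1}; the value 0 is excluded by [is_labelling]. *)
Definition gnc_type n : finType :=
  ({set {set 'I_n.+1}} * {ffun 'I_n.+1 -> 'I_n.+2})%type.

Definition is_labelling n (f : {ffun 'I_n.+1 -> 'I_n.+2}) :=
  [&& [forall x : 'I_n.+1, forall y : 'I_n.+1, (x <= y) ==> (f x <= f y)],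
      f ord0 == 1 :> nat &
      [exists m : 'I_n.+2, forall l : 'I_n.+2,
         (l \in codom f) == (1 <= l <= m)]].

Definition is_gnc n (T : gnc_type n) :=
  [&& is_tree T.1, noncrossing T.1 & is_labelling T.2].

(** * Words along root-to-vertex paths *)

Inductive step := Up | Level | Down.

Lemma step_eq_dec (x y : step) : {x = y} + {x <> y}.
Proof. by decide equality. Defined.

HB.instance Definition _ := hasDecEq.Build step (compareP step_eq_dec).

Definition step_of (a b : nat) : step :=
  if a < b then Up else if a == b then Level else Down.

Section Words.
Variable n : nat.
Implicit Types (T : gnc_type n) (p : seq 'I_n.+1).

(* The root is p_0 = ord0, and p lists the later vertices of a path from it. *)
Definition root_path T p := path (adj T.1) ord0 p && uniq (ord0 :: p).

(* Along a simple path from the root each vertex is the parent of the next. *)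
Definition word T p : seq step :=
  pairmap (fun x y => step_of (T.2 x) (T.2 y)) ord0 p.

(* A simple path from the root has at most n edges. *)
Definition contains T (s : seq step) :=
  [exists k : 'I_n.+1, exists p : k.-tuple 'I_n.+1,
     root_path T p && infix s (word T p)].

Definition avoids T (P : seq (seq step)) := all (fun s => ~~ contains T s) P.

End Words.

Definition GNC n (P : seq (seq step)) : {set gnc_type n} :=
  [set T | is_gnc T && avoids T P].

(** * Little Schroeder numbers

   A formal power series over rat is its coefficient function nat -> rat. *)

Local Open Scope ring_scope.

Definition fps_mul (a b : nat -> rat) (m : nat) : rat :=
  \sum_(i < m.+1) a i * b (m - i)%N.

(* First m coefficients of the square root, with constant term 1, of a series
   with constant term 1, by comparing coefficients in s * s = a. *)
Fixpoint fps_sqrt_seq (a : nat -> rat) (m : nat) : seq rat :=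
  if m is k.+1 then
    let s := fps_sqrt_seq a k in
    rcons s (if k == 0%N then 1
             else (a k - \sum_(1 <= i < k) s`_i * s`_(k - i)) / 2%:R)
  else [::].

Definition fps_sqrt (a : nat -> rat) (m : nat) : rat :=
  (fps_sqrt_seq a m.+1)`_m.

Lemma size_fps_sqrt_seq a m : size (fps_sqrt_seq a m) = m.
Proof. by elim: m => //= m IHm; rewrite size_rcons IHm. Qed.

Lemma nth_fps_sqrt_seq a m i :
  (i < m)%N -> (fps_sqrt_seq a m)`_i = fps_sqrt a i.
Proof.
elim: m => // m IHm; rewrite ltnS leq_eqVlt => /predU1P[-> //|lt_im].
by rewrite /= nth_rcons size_fps_sqrt_seq lt_im IHm.
Qed.

Lemma fps_sqrt0 a : fps_sqrt a 0 = 1.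
Proof. by []. Qed.

Lemma fps_sqrtK a : a 0%N = 1 -> fps_mul (fps_sqrt a) (fps_sqrt a) =1 a.
Proof.
move=> a0 [|m]; first by rewrite /fps_mul big_ord1 !fps_sqrt0 mulr1.
rewrite /fps_mul -(big_mkord xpredT
  (fun i => fps_sqrt a i * fps_sqrt a (m.+1 - i)%N)).
rewrite big_ltn // big_nat_recr //= subn0 subnn fps_sqrt0 mul1r mulr1.
have -> : fps_sqrt a m.+1 =
    (a m.+1 - \sum_(1 <= i < m.+1) fps_sqrt a i * fps_sqrt a (m.+1 - i)%N) / 2%:R.
  have seqS : fps_sqrt_seq a m.+2 = rcons (fps_sqrt_seq a m.+1)
      ((a m.+1 - \sum_(1 <= i < m.+1)
          (fps_sqrt_seq a m.+1)`_i * (fps_sqrt_seq a m.+1)`_(m.+1 - i)) / 2%:R).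
    by [].
  rewrite {1}/fps_sqrt seqS nth_rcons size_fps_sqrt_seq ltnn eqxx.
  congr ((_ - _) / _).
  rewrite big_nat_cond [RHS]big_nat_cond; apply: eq_bigr => i.
  rewrite andbT => /andP[i_gt0 lt_im]; rewrite !nth_fps_sqrt_seq //.
  by rewrite ltn_subrL i_gt0.
by field.
Qed.

(* The coefficients of (1 + t - sqrt (1 - 6 t + t^2)) / (4 t); the numerator
   has constant term 1 - 1 = 0. *)
Definition little_schroeder (m : nat) : rat :=
  ((1 + 'X : {poly rat})`_m.+1
   - fps_sqrt (fun k => (1 - 6%:R *: 'X + 'X^2 : {poly rat})`_k) m.+1) / 4%:R.

(** * The factors of the second formula *)

Definition catalan (i : nat) : rat := ('C(2 * i, i))%:R / (i.+1)%:R.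

(* This is the coefficient of s^j in the i-th power of the Catalan series,
   which is 1 for i = j = 0, where the quotient reads 0/0. *)
Definition catalan_power_coef (i j : nat) : rat :=
  if (i == 0%N) && (j == 0%N) then 1
  else i%:R / (2 * j + i)%:R * ('C(2 * j + i, j))%:R.

(* Main.v *)
From HB Require Import structures.
Require Import Defs.
From mathcomp Require Import all_boot all_order all_algebra.
From mathcomp Require Import zify ring.

(** Along an edge of a tree avoiding [h] the labels differ, and they increase
    weakly with the index, so [u] and [d] record whether the index goes up or
    down: avoiding [ud] or [du] depends on the tree alone.  Every chord of a
    non-crossing tree spans a gap between consecutive points that is itself an
    edge, hence the labels separate all chords as soon as they increase across
    those gaps, and a tree with [g] gaps that are not edges has [2 ^ g]
    admissible labellings.

    Let [j] be the largest neighbour of the root [a] of a tree on [a, b]. The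
    tree splits into a tree on [a, k] rooted at [a], a tree on [k + 1, j]
    rooted at [j] and a tree on [j, b] rooted at [j]; avoiding [du] means that
    the second one only goes down, and avoiding [ud] that it is a point.
    Splitting a tree that only goes down in the same way, the weighted series
    [D] of these (equivalently, by symmetry, of the trees avoiding [ud]) and
    [L] of the trees avoiding [du] satisfy
    [D = 1 + t (2 D - 1) D] and [L = 1 + t (2 L D - 1) L].  With
    [u = 1 / (1 + t)] and [C] the Catalan series, the solutions are
    [D = u C(2 t u^2)] and [L = u C(2 t u^2 D)]. *)

Set Implicit Arguments.
Unset Strict Implicit.
Unset Printing Implicit Defensive.

Import GRing.Theory Num.Theory.

(** * Shapes of trees and their parent maps *)

(* A [dtree] is a tree on an interval, rooted at its right end and with all
   steps down: in [DNode C A] the smallest neighbour [i] of the root [b] carries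
   [C] on [a, i], and the root carries [A] on [i + 1, b].  An [ltree] is a tree
   rooted at its left end and avoiding [du], with [LNode A B C] as in the
   header. *)
Inductive dtree := DLeaf | DNode of dtree & dtree.
Inductive ltree := LLeaf | LNode of ltree & dtree & ltree.

Lemma dtree_eq_dec (x y : dtree) : {x = y} + {x <> y}.
Proof. by decide equality. Defined.
HB.instance Definition _ := hasDecEq.Build dtree (compareP dtree_eq_dec).

Lemma ltree_eq_dec (x y : ltree) : {x = y} + {x <> y}.
Proof. by decide equality; apply: dtree_eq_dec. Defined.
HB.instance Definition _ := hasDecEq.Build ltree (compareP ltree_eq_dec).

Fixpoint dsize t := if t is DNode C A then (dsize C + dsize A).+1 else 0.
Fixpoint lsize t :=
  if t is LNode A B C then (lsize A + dsize B + lsize C).+1 else 0.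

Section Fit.
Variable p : nat -> nat.

(** [p] sends a vertex to its parent. The root of a piece is left unconstrained, because its parent
    lies in the tree around the piece. *)
Fixpoint dfit a t : Prop :=
  if t is DNode C A then
    [/\ dfit a C, p (a + dsize C) = (a + dsize C + dsize A).+1
      & dfit (a + dsize C).+1 A]
  else True.

Fixpoint lfit a t : Prop :=
  if t is LNode A B C then
    [/\ lfit a A, dfit (a + lsize A).+1 B, p (a + lsize A + dsize B).+1 = a
      & lfit (a + lsize A + dsize B).+1 C]
  else True.

(** A chord is named by its child end [v]. [crossing] is one of the two interleavings; exchanging
    the arguments gives the other. *)
Definition chord_min v := minn v (p v).
Definition chord_max v := maxn v (p v).
Definition crossing u v :=
  [&& chord_min u < chord_min v, chord_min v < chord_max u
    & chord_max u < chord_max v].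

Lemma dfit_bounds a t v :
  dfit a t -> a <= v < a + dsize t -> v < p v <= a + dsize t.
Proof.
elim: t a => [|C IHC A IHA] a /=; first by lia.
case=> /IHC{}IHC pi /IHA{}IHA va.
case: (ltngtP v (a + dsize C)) => [lt|gt|E]; last by rewrite E; lia.
  have := IHC; lia.
have := IHA; lia.
Qed.

Lemma dfit_noncrossing a t u v : dfit a t -> 
  a <= u < a + dsize t -> a <= v < a + dsize t -> ~~ crossing u v.
Proof.
elim: t a => [|C IHC A IHA] a /=; first by lia.
case=> fC pi fA hu hv.
have bC w := @dfit_bounds _ _ w fC; have bA w := @dfit_bounds _ _ w fA.
move: {IHC}(IHC _ fC) {IHA}(IHA _ fA) (bC u) (bC v) (bA u) (bA v).
rewrite /crossing /chord_min /chord_max.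
case: (ltngtP u (a + dsize C)) => [ltu|gtu|Eu];
  case: (ltngtP v (a + dsize C)) => [ltv|gtv|Ev];
  try (subst u); try (subst v); lia.
Qed.

Lemma lfit_bounds a t v : lfit a t -> a < v <= a + lsize t ->
  (a <= p v <= a + lsize t) && (p v != v).
Proof.
elim: t a => [|A IHA B C IHC] a /=; first by lia.
case=> /IHA{}IHA fB pj /IHC{}IHC va.
have := dfit_bounds (v := v) fB.
case: (ltngtP v (a + lsize A + dsize B).+1) => [lt|gt|E]; last by subst v; lia.
  case: (leqP v (a + lsize A)) => [le|gt]; last by lia.
  have := IHA; lia.
have := IHC; lia.
Qed.

Lemma lfit_noncrossing a t u v : lfit a t ->
  a < u <= a + lsize t -> a < v <= a + lsize t -> ~~ crossing u v.
Proof.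
elim: t a => [|A IHA B C IHC] a /=; first by lia.
case=> fA fB pj fC hu hv.
have bA w := @lfit_bounds _ _ w fA; have bC w := @lfit_bounds _ _ w fC.
have bB w := @dfit_bounds _ _ w fB.
move: (dfit_noncrossing (u := u) (v := v) fB) {IHC}(IHC _ fC) {IHA}(IHA _ fA).
move: (bC u) (bC v) (bA u) (bA v) (bB u) (bB v).
rewrite /crossing /chord_min /chord_max.
case: (leqP u (a + lsize A)); case: (leqP v (a + lsize A));
  case: (ltngtP u (a + lsize A + dsize B).+1) => [ltu|gtu|Eu];
  case: (ltngtP v (a + lsize A + dsize B).+1) => [ltv|gtv|Ev];
  try (subst u); try (subst v); lia.
Qed.

(** Here [v] is the last vertex of a factor [du]: the step into [p v] goes down and the step into
    [v] goes up. *)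
Definition down_up v := (p v < v) && (p v < p (p v)).

(** The second part has no up step, the first keeps the root [a], and the root of the third is
    entered by the up step from [a]. Children of [a] are excluded by [a < p v], since [p a] is
    arbitrary. *)
Lemma lfit_down_up a t v : lfit a t ->
  a < v <= a + lsize t -> a < p v -> ~~ down_up v.
Proof.
elim: t a => [|A IHA B C IHC] a /=; first by lia.
case=> fA fB pj fC hv apv; rewrite /down_up.
have bA w := @lfit_bounds _ _ w fA; have bC w := @lfit_bounds _ _ w fC.
have bB w := @dfit_bounds _ _ w fB.
case: (ltngtP v (a + lsize A + dsize B).+1) => [lt|gt|E]; last by subst v; lia.
  case: (leqP v (a + lsize A)) => [le|gt].
    by apply: IHA fA _ _; lia.
  have := bB v; lia.
have := bC v; have := IHC _ fC; rewrite /down_up => IH bv.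
case: (ltngtP (p v) (a + lsize A + dsize B).+1) => [?|?|Ep].
- lia.
- apply: IH; lia.
- rewrite Ep pj; lia.
Qed.

(** Cut at the smallest neighbour [i] of the root. A chord from below [i] to beyond [i] would cross
    the chord of [i], or end at the root against minimality. *)
Lemma dfit_exists a m :
  (forall v, a <= v < a + m -> v < p v <= a + m) ->
  (forall u v, a <= u < a + m -> a <= v < a + m -> ~~ crossing u v) ->
  exists2 t, dsize t = m & dfit a t.
Proof.
elim/ltn_ind: m a => -[|m] IH a bnd nc; first by exists DLeaf.
have exi : exists i, (a <= i < a + m.+1) && (p i == a + m.+1).
  (* The last vertex before the root has only the root above it. *)
  by exists (a + m); have := bnd (a + m); lia.
have [i /andP[ai /eqP pi] min_i] := ex_minnP exi.
have [|||C sC fC] := IH (i - a) _ a; first lia.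
- move=> v va; have := bnd v; have := min_i v; have := nc v i.
  rewrite /crossing /chord_min /chord_max; lia.
- by move=> u v ? ?; apply: nc; lia.
have [|||A sA fA] := IH (a + m - i) _ i.+1; first lia.
- by move=> v va; have := bnd v; lia.
- by move=> u v ? ?; apply: nc; lia.
exists (DNode C A) => /=; first by lia.
have -> : a + dsize C = i by lia.
by split=> //; lia.
Qed.

(** The interval is cut at the largest neighbour [j] of the root and after the last vertex [k]
    before [j] that is entered by an up step. *)
Lemma lfit_exists a m :
  (forall v, a < v <= a + m -> (a <= p v <= a + m) && (p v != v)) ->
  (forall u v, a < u <= a + m -> a < v <= a + m -> ~~ crossing u v) ->
  (forall v, a < v <= a + m -> a < p v -> ~~ down_up v) ->
  exists2 t, lsize t = m & lfit a t.
Proof.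
elim/ltn_ind: m a => -[|m] IH a bnd nc du; first by exists LLeaf.
have exj : exists j, (a < j <= a + m.+1) && (p j == a).
  have : a < a + m.+1 <= a + m.+1 by lia.
  have : p (a + m.+1) < a + m.+1 by have := bnd (a + m.+1); lia.
  (* The last vertex is entered by an up step. Avoiding [du], so is each of its ancestors other than
     the root, and the decreasing chain of parents ends at a child of [a]. *)
  elim/ltn_ind: {1 2 3 4}(a + m.+1) => w IHw pw aw.
  have [E|ne] := eqVneq (p w) a; first by exists w; rewrite aw E eqxx.
  apply: (IHw (p w)) => //; have := bnd w; have := bnd (p w); have := du w;
  rewrite /down_up; lia.
have ub_j j : (a < j <= a + m.+1) && (p j == a) -> j <= a + m.+1 by lia.
have [j /andP[aj /eqP pj] max_j] := ex_maxnP exj ub_j.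
have bnd_j v : a < v < j -> a <= p v <= j.
  have := bnd v; have := nc j v; have := nc v j.
  rewrite /crossing /chord_min /chord_max; lia.
(* The alternative [k == a] covers the case of no up step into a vertex strictly between [a] and
   [j]. *)
have exk : exists k, (a <= k < j) && ((k == a) || (p k < k)).
  by exists a; lia.
have ub_k k : (a <= k < j) && ((k == a) || (p k < k)) -> k <= j by lia.
have [k /andP[ak k_up] max_k] := ex_maxnP exk ub_k.
(* Under the chord of a down step into [v], the parents of a vertex entered by an up step decrease
   without crossing that chord. They reach [v], which yields a factor [du]. *)
have no_up_below v w : a < v -> v < w < p v -> p v <= j -> p w < w -> False.
  move=> av; elim/ltn_ind: w => w IHw vw pvj pw.
  have := du w; have := nc w v; have := bnd w; have := bnd (p w).
  rewrite /crossing /chord_min /chord_max /down_up => bpw bw ncw duw.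
  have [E|ne] := eqVneq (p w) v; first by rewrite E in duw; lia.
  apply: (IHw (p w)); lia.
have [||||A sA fA] := IH (k - a) _ a; first lia.
- move=> v va; have := bnd v; have := bnd_j v.
  have := @no_up_below v k; have [->|] := eqVneq v k; lia.
- by move=> u v ? ?; apply: nc; lia.
- by move=> v ? ?; apply: du; lia.
have [||B sB fB] := @dfit_exists k.+1 (j - k.+1).
- move=> v va; have := bnd v; have := bnd_j v; have := max_k v; lia.
- by move=> u v ? ?; apply: nc; lia.
have [||||C sC fC] := IH (a + m.+1 - j) _ j; first lia.
(* A parent strictly between [a] and [j] would give a chord crossing that of [j]; the parent [a]
   contradicts maximality of [j]. *)
- move=> v va; have := bnd v; have := max_j v; have := nc j v.
  rewrite /crossing /chord_min /chord_max; lia.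
- by move=> u v ? ?; apply: nc; lia.
- by move=> v ? ?; apply: du; lia.
exists (LNode A B C) => /=; first by lia.
have -> : a + lsize A = k by lia.
have -> : (k + dsize B).+1 = j by lia.
by split.
Qed.

(** The cut point is the smallest child of the root, which [p] determines. *)
Lemma dfit_inj a t t' :
  dfit a t -> dfit a t' -> dsize t = dsize t' -> t = t'.
Proof.
elim: t t' a => [|C IHC A IHA] [|C' A'] a //=.
move=> [fC pi fA] [fC' pi' fA'] [eq_s].
have eqC : dsize C = dsize C'.
  case: (ltngtP (dsize C) (dsize C')) => // lt.
    have := dfit_bounds (v := a + dsize C) fC'; lia.
  have := dfit_bounds (v := a + dsize C') fC; lia.
rewrite -eqC in fA' eq_s.
by congr DNode; [apply: IHC fC fC' _ | apply: IHA fA fA' _]; lia.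
Qed.

(** [p] determines both cuts: [j] is the largest child of [a], and the last vertex of the first part
    has no larger parent, whereas every vertex of the second part before its root does. *)
Lemma lfit_inj a t t' :
  lfit a t -> lfit a t' -> lsize t = lsize t' -> t = t'.
Proof.
elim: t t' a => [|A IHA B C IHC] [|A' B' C'] a //=.
move=> [fA fB pj fC] [fA' fB' pj' fC'] [eq_s].
have eqC : lsize A + dsize B = lsize A' + dsize B'.
  case: (ltngtP (lsize A + dsize B) (lsize A' + dsize B')) => // lt.
    have := lfit_bounds (v := (a + lsize A' + dsize B').+1) fC; lia.
  have := lfit_bounds (v := (a + lsize A + dsize B).+1) fC'; lia.
have eqA : lsize A = lsize A'.
  case: (ltngtP (lsize A) (lsize A')) => // lt.
    have := lfit_bounds (v := a + lsize A') fA'.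
    have := dfit_bounds (v := a + lsize A') fB; lia.
  have := lfit_bounds (v := a + lsize A) fA.
  have := dfit_bounds (v := a + lsize A) fB'; lia.
rewrite -addnA -eqC addnA in fC'; rewrite -eqA in fB' eq_s.
congr LNode; [exact: IHA fA fA' _ | apply: dfit_inj fB fB' _ |
  apply: IHC fC fC' _]; lia.
Qed.

(** The number of gaps between consecutive points that are not edges. The gap between the two pieces
    is an edge exactly when the second is a point. *)
Fixpoint dgaps t :=
  if t is DNode C A then dgaps C + dgaps A + (0 < dsize A) else 0.

(** Only the chord from [a] to [j] joins the first part to the second, so the gap between them is an
    edge exactly when both are points. *)
Fixpoint lgaps t :=
  if t is LNode A B C then
    lgaps A + dgaps B + lgaps C + (0 < lsize A + dsize B)
  else 0.

(** A chord to the root is itself such a gap if the second piece is a point; otherwise the chord of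
    the first vertex of that piece lies under it. *)
Lemma dfit_gap a t v : dfit a t -> a <= v < a + dsize t ->
  exists2 i, v <= i < p v & p i = i.+1.
Proof.
elim: t a v => [|C IHC A IHA] a v /=; first by lia.
case=> fC pi fA va; have [lt|gt|->] := ltngtP v (a + dsize C).
- by apply: IHC fC _; lia.
- by apply: IHA fA _; lia.
have [A0|A0] := posnP (dsize A).
  by exists (a + dsize C); rewrite pi A0; lia.
have [|i ? ?] := IHA _ (a + dsize C).+1 fA; first lia.
by exists i => //; have := dfit_bounds (v := (a + dsize C).+1) fA; lia.
Qed.

(** The gap from [i] to [i.+1] is an edge, in either orientation; [a < i] discards the arbitrary
    value of [p] at the root. *)
Definition short_gap a i := (p i.+1 == i) || (a < i) && (p i == i.+1).

Lemma lfit_gap a t v : lfit a t -> a < v <= a + lsize t ->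
  exists2 i, chord_min v <= i < chord_max v & short_gap a i.
Proof.
rewrite /chord_min /chord_max /short_gap.
elim: t a v => [|A IHA B C IHC] a v /=; first by lia.
case=> fA fB pj fC va.
have inA w : a < w <= a + lsize A -> exists2 i, minn w (p w) <= i < maxn w (p w)
  & (p i.+1 == i) || (a < i) && (p i == i.+1) by exact: IHA.
have inB w : a + lsize A < w <= a + lsize A + dsize B ->
    exists2 i, minn w (p w) <= i < maxn w (p w)
      & (p i.+1 == i) || (a < i) && (p i == i.+1).
  move=> hw; have [|i ? pi] := dfit_gap (v := w) fB; first lia.
  by exists i; lia.
have [lt|gt|->] := ltngtP v (a + lsize A + dsize B).+1.
- by case: (leqP v (a + lsize A)) => ?; [apply: inA | apply: inB]; lia.
- have [|i ? ?] := IHC _ v fC; first lia.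
  by exists i => //; lia.
rewrite pj; have [A0|A0] := posnP (lsize A); last first.
  have [|i ? ?] := inA a.+1; first lia.
  by exists i => //; have := lfit_bounds (v := a.+1) fA; lia.
have [B0|B0] := posnP (dsize B).
  by exists a; move: pj; rewrite A0 B0 !addn0 => pj; lia.
have [|i ? ?] := inB (a + lsize A).+1; first lia.
by exists i => //; have := dfit_bounds (v := (a + lsize A).+1) fB; lia.
Qed.

Lemma dgapsE a t : dfit a t ->
  \sum_(a <= i < a + dsize t) (p i != i.+1) = dgaps t.
Proof.
elim: t a => [|C IHC A IHA] a /=; first by rewrite addn0 big_geq.
case=> fC pi fA.
rewrite (big_cat_nat (n := a + dsize C)) /=; [|lia|lia].
rewrite IHC // big_ltn; last by lia.
have -> : a + (dsize C + dsize A).+1 = (a + dsize C).+1 + dsize A by lia.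
by rewrite IHA // pi; lia.
Qed.

Lemma lgapsE a t : lfit a t ->
  \sum_(a <= i < a + lsize t) ~~ short_gap a i = lgaps t.
Proof.
elim: t a => [|A IHA B C IHC] a /=; first by rewrite addn0 big_geq.
case=> fA fB pj fC.
have bA w := @lfit_bounds _ _ w fA; have bB w := @dfit_bounds _ _ w fB.
rewrite (big_cat_nat (n := a + lsize A)) /=; [|lia|lia].
rewrite IHA // big_ltn; last by lia.
rewrite (big_cat_nat (n := (a + lsize A).+1 + dsize B)) /=; [|lia|lia].
have -> : \sum_((a + lsize A).+1 <= i < (a + lsize A).+1 + dsize B)
    ~~ short_gap a i = dgaps B.
  rewrite -(dgapsE fB) [LHS]big_nat_cond [RHS]big_nat_cond.
  apply: eq_bigr => i; rewrite andbT => hi; rewrite /short_gap.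
  have pi1 : p i.+1 != i.
    have [->|?] := eqVneq i (a + lsize A + dsize B); first by lia.
    have := bB i.+1; lia.
  by rewrite (negbTE pi1) /=; lia.
have -> : \sum_((a + lsize A).+1 + dsize B <= i <
                a + (lsize A + dsize B + lsize C).+1) ~~ short_gap a i = lgaps C.
  rewrite -(IHC _ fC).
  have -> : a + (lsize A + dsize B + lsize C).+1
            = (a + lsize A + dsize B).+1 + lsize C by lia.
  rewrite addSn [LHS]big_nat_cond [RHS]big_nat_cond.
  apply: eq_bigr => i; rewrite andbT => hi; rewrite /short_gap.
  have [->|?] := eqVneq i (a + lsize A + dsize B).+1; first by rewrite pj; lia.
  lia.
have -> : (short_gap a (a + lsize A)) = (lsize A + dsize B == 0).
  rewrite /short_gap; have [A0|A0] := posnP (lsize A).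
    have [B0|B0] := posnP (dsize B).
      by move: pj; rewrite A0 B0 !addn0 => ->; lia.
    have := bB a.+1; rewrite A0 addn0; lia.
  have := bA (a + lsize A).
  have [B0|B0] := posnP (dsize B).
    by move: pj; rewrite B0 !addn0 => ->; lia.
  have := bB (a + lsize A).+1; lia.
lia.
Qed.

End Fit.

Lemma dfit_ext p q a t : (forall v, a <= v < a + dsize t -> p v = q v) ->
  dfit p a t -> dfit q a t.
Proof.
elim: t a => [|C IHC A IHA] a //= pq [fC pi fA]; split.
- by apply: IHC fC => v ?; apply: pq; lia.
- by rewrite -pq //; lia.
- by apply: IHA fA => v ?; apply: pq; lia.
Qed.

Lemma lfit_ext p q a t : (forall v, a < v <= a + lsize t -> p v = q v) ->
  lfit p a t -> lfit q a t.
Proof.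
elim: t a => [|A IHA B C IHC] a //= pq [fA fB pj fC]; split.
- by apply: IHA fA => v ?; apply: pq; lia.
- by apply: dfit_ext fB => v ?; apply: pq; lia.
- by rewrite -pq //; lia.
- by apply: IHC fC => v ?; apply: pq; lia.
Qed.

(** A parent map realising the shape; the root gets itself as default value. *)
Fixpoint dparent a t v :=
  if t is DNode C A then
    if v < a + dsize C then dparent a C v
    else if v == a + dsize C then (a + dsize C + dsize A).+1
    else dparent (a + dsize C).+1 A v
  else v.

Fixpoint lparent a t v :=
  if t is LNode A B C then
    if v <= a + lsize A then lparent a A v
    else if v <= a + lsize A + dsize B then dparent (a + lsize A).+1 B v
    else if v == (a + lsize A + dsize B).+1 then a
    else lparent (a + lsize A + dsize B).+1 C v
  else v.

Lemma dfit_dparent a t : dfit (dparent a t) a t.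
Proof.
elim: t a => [//|C IHC A IHA] a /=; split.
- by apply: dfit_ext (IHC a) => v va; rewrite ifT //; lia.
- by rewrite ltnn eqxx.
- by apply: dfit_ext (IHA _) => v va; rewrite !ifF //; lia.
Qed.

Lemma lfit_lparent a t : lfit (lparent a t) a t.
Proof.
elim: t a => [//|A IHA B C IHC] a /=; split.
- by apply: lfit_ext (IHA a) => v va; rewrite ifT //; lia.
- by apply: dfit_ext (dfit_dparent _ _) => v va; rewrite ifF ?ifT //; lia.
- by rewrite ifF; [rewrite ifF; [rewrite eqxx | lia] | lia].
- by apply: lfit_ext (IHC _) => v va; rewrite !ifF //; lia.
Qed.

Lemma dfit_dparentE p a t v : dfit p a t -> a <= v < a + dsize t ->
  p v = dparent a t v.
Proof.
elim: t a => [|C IHC A IHA] a /=; first by lia.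
case=> fC pi fA va; case: ltngtP => [lt|gt|->//].
  by apply: IHC fC _; lia.
by apply: IHA fA _; lia.
Qed.

Lemma lfit_lparentE p a t v : lfit p a t -> a < v <= a + lsize t ->
  p v = lparent a t v.
Proof.
elim: t a => [|A IHA B C IHC] a /=; first by lia.
case=> fA fB pj fC va.
case: leqP => [le|gt]; first by apply: IHA fA _; lia.
case: leqP => [le|gt']; first by apply: dfit_dparentE fB _; lia.
by case: eqVneq => [->//|ne]; apply: IHC fC _; lia.
Qed.

(** The mirror image of a tree with all steps down: the largest neighbour of the left root carries
    the image of [C], and the root keeps that of [A]. *)
Fixpoint up_tree t :=
  if t is DNode C A then LNode (up_tree A) DLeaf (up_tree C)
  else LLeaf.

(** If some second part is not a point, its first vertex is entered by a down step. *)
Lemma up_treeP p a t : lfit p a t ->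
  (forall v, a < v <= a + lsize t -> p v < v) <-> exists t', t = up_tree t'.
Proof.
move=> fit_t; split=> [|[t' Et]]; last first.
  rewrite {t}Et in fit_t *; elim: t' a fit_t => [|C IHC A IHA] a /=; first by lia.
  rewrite !addn0 => -[fA _ pj fC] v va.
  case: (ltngtP v (a + lsize (up_tree A)).+1) => [lt|gt|->]; last by lia.
    by apply: IHA fA _ _; lia.
  by apply: IHC fC _ _; lia.
elim: t a fit_t => [|A IHA B C IHC] a /=; first by exists DLeaf.
case=> fA fB pj fC up.
have [|A' ->] := IHA _ fA; first by move=> v ?; apply: up; lia.
have [|C' ->] := IHC _ fC; first by move=> v ?; apply: up; lia.
exists (DNode C' A'); case: B fB up {pj fC} => // C1 A1 fB up.
have := dfit_bounds (v := (a + lsize A).+1) fB.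
have := up (a + lsize A).+1; rewrite /=; lia.
Qed.

Lemma lsize_up_tree t : lsize (up_tree t) = dsize t.
Proof. by elim: t => //= C -> A ->; rewrite addn0 addnC. Qed.

Lemma lgaps_up_tree t : lgaps (up_tree t) = dgaps t.
Proof. elim: t => //= C -> A ->; rewrite !lsize_up_tree; lia. Qed.

(** * Parent maps and non-crossing trees *)

(** The rank [d] certifies that every chain of parents ends at 0. *)
Definition parent_map n (p d : nat -> nat) :=
  forall v, 0 < v <= n -> (p v <= n) && (d (p v) < d v).

Definition edges n (p : nat -> nat) : {set {set 'I_n.+1}} :=
  [set [set v; inord (p v)] | v : 'I_n.+1 & v != ord0].

Lemma set2_inj (T : finType) (x y u v : T) :
  [set x; y] = [set u; v] -> (x = u /\ y = v) \/ (x = v /\ y = u).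
Proof.
move=> E.
have := set21 x y; have := set22 x y; rewrite E !inE.
have := set21 u v; have := set22 u v; rewrite -E !inE.
do 4![case/orP=> /eqP ?]; subst; auto.
Qed.

Section ParentMap.
Variables (n : nat) (p d : nat -> nat).
Hypothesis pm : parent_map n p d.
Local Notation point := 'I_n.+1.
Local Notation E := (edges n p).
Implicit Types (u v x y z : point) (s : seq point).

Lemma adj_sym (F : {set {set point}}) x y : adj F x y = adj F y x.
Proof. by rewrite /adj /= setUC. Qed.

Definition child : rel point := [rel x y | (y != ord0) && (p y == x)].

Lemma child_rank x y : child x y -> d x < d y.
Proof.
case/andP=> y0 /eqP <-; have := pm (v := y).
rewrite lt0n -(inj_eq val_inj) in y0 *.
by rewrite y0 -ltnS ltn_ord => /(_ isT)/andP[].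
Qed.

Lemma inord_parent y : y != ord0 -> (inord (p y) : point) = p y :> nat.
Proof.
move=> y0; rewrite inordK // ltnS.
have := pm (v := y); rewrite lt0n -(inj_eq val_inj) in y0 *.
by rewrite y0 -ltnS ltn_ord => /(_ isT)/andP[].
Qed.

Lemma child_inord y : y != ord0 -> child (inord (p y)) y.
Proof. by move=> y0; rewrite /child /= y0 inord_parent ?eqxx. Qed.

Lemma child_uniq x x' y : child x y -> child x' y -> x = x'.
Proof.
move=> /andP[_ /eqP Ex] /andP[_ /eqP Ex'].
by apply: ord_inj; rewrite -Ex -Ex'. Qed.

Lemma adj_edges x y : adj E x y = child x y || child y x.
Proof.
apply/imsetP/orP => [[v]|].
  rewrite inE => v0 /set2_inj[[-> ->]|[-> ->]]; [right | left]; exact: child_inord.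
by case=> c; [exists y | exists x]; rewrite ?inE; case/andP: (c) => // y0 _;
  rewrite -(child_uniq (child_inord y0) c) // setUC.
Qed.

Lemma rank_ind (P : point -> Prop) :
  P ord0 -> (forall x y, child x y -> P x -> P y) -> forall y, P y.
Proof.
move=> P0 IH y; have [m] := ubnP (d y); elim: m y => // m IHm y /ltnSE le_dy.
have [->//|y0] := eqVneq y ord0.
apply: (IH (inord (p y))); first exact: child_inord.
by apply: IHm; apply: leq_trans le_dy; apply/child_rank/child_inord.
Qed.

Lemma is_tree_edges : is_tree E.
Proof.
have simpleE : simple_graph E.
  apply/forall_inP=> A /imsetP[v]; rewrite inE => v0 ->; rewrite cards2.
  have := child_rank (child_inord v0).
  by case: (eqVneq v (inord (p v))) => // <-; rewrite ltnn.
apply/and3P; split=> //.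
  have c0 : forall y, connect (adj E) ord0 y.
    apply: rank_ind => [|x y xy c0x]; first exact: connect0.
    by apply: connect_trans c0x (connect1 _); rewrite adj_edges xy.
  have sym : connect_sym (adj E) by apply: sym_connect_sym => x y; exact: adj_sym.
  apply/forallP=> x; apply/forallP=> y; apply: connect_trans (c0 y).
  by rewrite sym.
(* In a cycle both neighbours of a vertex of maximal rank are its parent. *)
apply/forallP=> k; apply/forallP=> c; apply/implyP=> k_gt2.
apply/negP => /andP[cyc uniq_c].
have szc : size c = k by rewrite size_tuple.
have [x xc max_x] : exists2 x, x \in tval c &
    forall y, y \in tval c -> d y <= d x.
  have x0c : nth ord0 c 0 \in tval c by apply: mem_nth; rewrite szc; lia.
  by case: (arg_maxnP (fun y => d y) (x0c : (mem (tval c)) _)) => x; exists x.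
have [i s Es] := rot_to xc.
have mem_s : x :: s =i c by move=> y; rewrite -Es mem_rot.
have : cycle (adj E) (x :: s) by rewrite -Es rot_cycle.
have : uniq (x :: s) by rewrite -Es rot_uniq.
have : 2 < size (x :: s) by rewrite -Es size_rot szc.
case: s {Es} mem_s => [|y [|z s]] // mem_s _ uniq_s.
rewrite [cycle _ _]/= rcons_path => /and4P[xy _ _].
set w := last z s => wx.
have par_x u : u \in x :: y :: z :: s -> adj E u x -> child u x.
  rewrite mem_s adj_edges => /max_x le_ux /orP[//|/child_rank]; lia.
have ws : w \in z :: s by rewrite /w mem_last.
have : w = y.
  apply: (@child_uniq _ _ x); apply: par_x => //; rewrite ?(adj_sym _ y) //;
  by rewrite !inE ?eqxx ?orbT //; move: ws; rewrite inE => ->; rewrite !orbT.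
by move=> wy; case/and3P: uniq_s => _; rewrite -wy ws.
Qed.

Lemma noncrossing_edges :
  noncrossing E <-> forall u v, u != ord0 -> v != ord0 -> ~~ crossing p u v.
Proof.
rewrite /crossing /chord_min /chord_max; split=> [nc u v u0 v0|nc].
  move: (child_inord u0) (child_inord v0) (inord_parent u0) (inord_parent v0).
  set pu : point := inord (p u); set pv : point := inord (p v) => cu cv <- <-.
  have adjE x y : child x y -> adj E x y /\ adj E y x.
    by rewrite !adj_edges => ->; rewrite orbT.
  have [u1 u2] := adjE _ _ cu; have [v1 v2] := adjE _ _ cv.
  have ncE a b c e : adj E a b -> adj E c e -> ~~ [&& a < c, c < b & b < e].
    move=> ab ce; have := forallP (forallP (forallP (forallP nc a) b) c) e.
    by rewrite ab ce.
  case: (leqP u pu) => hu; case: (leqP v pv) => hv; apply: ncE => //.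
apply/forallP=> a; apply/forallP=> b; apply/forallP=> c; apply/forallP=> e.
apply/implyP.
rewrite !adj_edges => /andP[/orP[]/andP[x0 /eqP Ex] /orP[]/andP[y0 /eqP Ey]];
  have := nc _ _ x0 y0; rewrite Ex Ey; lia.
Qed.
End ParentMap.

(** * Every tree comes from a parent map *)

Section TreeParent.
Variable n : nat.
Local Notation point := 'I_n.+1.
Implicit Types (E : {set {set point}}) (x y : point).

(** A simple path from [x] to [y] in the remaining graph would close up with the removed edge to a
    cycle. *)
Lemma tree_bridge E x y : acyclic_graph E -> x != y -> adj E x y ->
  ~~ connect (adj (E :\ [set x; y])) x y.
Proof.
move=> acE ne_xy Exy; apply/connectP => -[q path_q y_last].
case/shortenP: path_q y_last => q' path_q' uniq_q' _ y_last.
have lt_q : size (x :: q') < n.+2.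
  by have := max_card (mem (x :: q')); rewrite (card_uniqP uniq_q') card_ord.
move/forallP/(_ (Ordinal lt_q))/forallP/(_ (in_tuple (x :: q'))): acE.
rewrite -[cycle _ _ && _]/(cycle (adj E) (x :: q') && uniq (x :: q')).
rewrite uniq_q' andbT /= rcons_path -y_last.
rewrite adj_sym Exy andbT.
have -> : path (adj E) x q'.
  by apply: sub_path path_q' => u v; rewrite /adj /= !inE => /andP[].
(* The cycle has at least three vertices: one would mean [x = y], and two would use the removed
   edge. *)
rewrite implybF -leqNgt.
case: q' path_q' y_last {uniq_q' lt_q} => [_ /= yx|z [|//] /=].
  by rewrite yx eqxx in ne_xy.
by rewrite andbT /adj /= => Exz yz; rewrite yz !inE eqxx in Exz.
Qed.

(** The parent of a vertex is a neighbour closer to the root, and the rank is the distance to the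
    root. *)
Lemma tree_parent E : is_tree E ->
  exists p d, parent_map n p d /\ E = edges n p.
Proof.
case/and3P=> simpleE connE acE.
pose reach v := [pred k | [exists q : k.-tuple point,
  path (adj E) ord0 q && (last ord0 q == v)]].
have reachP v : exists k, reach v k.
  have /connectP[q path_q v_last] := forallP (forallP connE ord0) v.
  exists (size q); apply/existsP; exists (in_tuple q).
  by rewrite /= path_q -v_last eqxx.
pose dist v := ex_minn (reachP v).
have closer v : exists u, (v != ord0) ==> adj E v u && (dist u < dist v).
  have [->|v0] := eqVneq v ord0; first by exists ord0.
  rewrite {2}/dist; case: ex_minnP => k /existsP[[q /= /eqP szq] /andP[]].
  case/lastP: q szq => [|q w] szq.
    by move=> _ /= /eqP v0'; rewrite -v0' eqxx in v0.
  rewrite rcons_path last_rcons => /andP[path_q adj_q] /eqP wv _.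
  exists (last ord0 q); rewrite adj_sym -wv adj_q /= -szq size_rcons ltnS.
  rewrite /dist; case: ex_minnP => m _; apply.
  by apply/existsP; exists (in_tuple q); rewrite /= path_q eqxx.
have [par parP] := fin_all_exists closer.
pose p k : nat := par (inord k); pose d k := dist (inord k).
have pE (v : point) : p v = par v by rewrite /p inord_val.
have dE (v : point) : d v = dist v by rewrite /d inord_val.
have pm : parent_map n p d.
  move=> v /andP[v_gt0 v_le].
  have Ev : (inord v : point) = v :> nat by rewrite inordK.
  rewrite -Ev pE -ltnS ltn_ord /= !dE.
  have := parP (inord v); rewrite -(inj_eq val_inj) /= Ev -lt0n v_gt0.
  by case/andP.
have childE x y : child p x y = (y != ord0) && (par y == x).
  by rewrite /child /= pE.
have adjE x y : adj (edges n p) x y -> adj E x y.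
  have sub u v : child p u v -> adj E u v.
    rewrite childE => /andP[v0 /eqP <-].
    by have := parP v; rewrite v0 adj_sym => /andP[].
  by rewrite (adj_edges pm) => /orP[/sub//|/sub]; rewrite adj_sym.
exists p, d; split=> //; apply/setP=> A; apply/idP/idP => [EA|]; last first.
  case/imsetP=> v; rewrite inE => v0 ->.
  apply: adjE; rewrite (adj_edges pm) orbC; apply/orP; left; exact: (child_inord pm).
have /cards2P[x [y [ne_xy EA2]]] := forall_inP simpleE _ EA.
(* An edge of E outside the parent map would close a cycle with the two
   parent chains to the root. *)
rewrite EA2 in EA *; apply: contraT => nEA.
have c0 z : connect (adj (E :\ [set x; y])) ord0 z.
  elim/(rank_ind pm): z => [|u v uv c0u]; first exact: connect0.
  apply: connect_trans c0u (connect1 _).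
  have auv : adj (edges n p) u v by rewrite (adj_edges pm) uv.
  rewrite /adj /= !inE (adjE _ _ auv : _ \in _) andbT.
  by apply: contraNneq nEA => <-.
have := tree_bridge acE ne_xy EA; rewrite (connect_trans _ (c0 y)) //.
rewrite (sym_connect_sym (e := adj _)) // => u v; exact: adj_sym.
Qed.
End TreeParent.

(** * Root paths and their words *)

Section RootPaths.
Variables (n : nat) (p d : nat -> nat) (f : {ffun 'I_n.+1 -> 'I_n.+2}).
Hypothesis pm : parent_map n p d.
Local Notation point := 'I_n.+1.
Local Notation T := ((edges n p, f) : gnc_type n).
Implicit Types (x y z : point) (s : seq point).

(** A simple path from the root never steps to a parent, since it has just come from there.
    Conversely, ranks increase along child steps, so no vertex repeats. *)
Lemma root_pathE s : root_path T s = path (child p) ord0 s.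
Proof.
apply/idP/idP => [|path_s]; last first.
  apply/andP; split.
    by apply: sub_path path_s => x y; rewrite (adj_edges pm) => ->.
  have /(sorted_uniq _ _) : sorted (relpre (fun x => d x) ltn) (ord0 :: s).
    by apply: sub_path path_s => x y; apply: (child_rank pm).
  by apply=> [x y z|x] /=; [apply: ltn_trans | rewrite ltnn].
(* The invariant says that the parent of the current vertex does not occur in the rest of the
   path. *)
have gen x : (x == ord0) || ((inord (p x) : point) \notin s) ->
    path (adj (edges n p)) x s && uniq (x :: s) -> path (child p) x s.
  elim: s x => //= y s IHs x px /and3P[/andP[xy path_s]].
  rewrite inE negb_or => /andP[ne_xy xs] /andP[ys uniq_s].
  have cxy : child p x y.
    move: xy; rewrite (adj_edges pm) => /orP[//|cyx].
    have x0 : x != ord0 by case/andP: cyx.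
    rewrite (negbTE x0) (child_uniq (child_inord pm x0) cyx) /= in px.
    by rewrite inE eqxx in px.
  rewrite cxy IHs ?path_s ?ys ?uniq_s //.
  have y0 : y != ord0 by case/andP: cxy.
  by rewrite (child_uniq (child_inord pm y0) cxy) xs orbT.
by apply: gen; rewrite eqxx.
Qed.

Lemma root_path_to y : exists2 s, path (child p) ord0 s & last ord0 s = y.
Proof.
elim/(rank_ind pm): y => [|x y xy [s path_s last_s]]; first by exists [::].
by exists (rcons s y); rewrite ?last_rcons // rcons_path path_s last_s.
Qed.

Definition edge_step x y := step_of (f x) (f y).

Lemma containsP w : reflect
  (exists2 s, path (child p) ord0 s & infix w (pairmap edge_step ord0 s))
  (contains T w).
Proof.
apply: (iffP existsP) => [[k /existsP[q /andP[path_q inf_q]]]|[s path_s inf_s]].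
  by exists q; rewrite // -root_pathE.
have root_s : root_path T s by rewrite root_pathE.
have lt_s : size s < n.+1.
  have /andP[_ uniq_s] := root_s.
  by have := max_card (mem (ord0 :: s)); rewrite (card_uniqP uniq_s) card_ord.
exists (Ordinal lt_s); apply/existsP; exists (in_tuple s).
by rewrite root_s.
Qed.

(** Every vertex ends some root path, so each edge is the last step of a root path. For [contains2]
    the path is extended by two edges. *)
Lemma contains1 a :
  contains T [:: a] <-> exists x y, child p x y /\ edge_step x y = a.
Proof.
split=> [/containsP[s path_s]|[x [y [xy <-]]]].
  rewrite infix1s; case/(nthP a) => i; rewrite size_pairmap => lt_i.
  rewrite (nth_pairmap ord0) // => Ei.
  by exists (nth ord0 (ord0 :: s) i), (nth ord0 s i); split=> //; apply/pathP.
have [s path_s last_s] := root_path_to x.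
apply/containsP; exists (rcons s y); first by rewrite rcons_path path_s last_s.
by rewrite -cats1 pairmap_cat /= last_s suffix_infix.
Qed.

Lemma contains2 a b : contains T [:: a; b] <->
  exists x y z, [/\ child p x y, child p y z, edge_step x y = a
                  & edge_step y z = b].
Proof.
split=> [/containsP[s path_s]|[x [y [z [xy yz <- <-]]]]].
  case/infixP=> w1 [w2 Es].
  have nth_s i : i < size s -> let u := nth ord0 (ord0 :: s) i in
      let v := nth ord0 s i in
      child p u v /\ edge_step u v = nth a (w1 ++ [:: a, b & w2]) i.
    move=> lt_i u v; split; first by apply/pathP.
    by rewrite -[_ ++ _]Es (nth_pairmap ord0).
  have szs : size s = size w1 + (size w2).+2.
    by rewrite -(size_pairmap edge_step ord0) Es size_cat.
  have [|c1 e1] := nth_s (size w1); first by lia.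
  have [|c2 e2] := nth_s (size w1).+1; first by lia.
  do 3![eexists]; split; [exact: c1 | exact: c2 | |].
    by rewrite e1 nth_cat ltnn subnn.
  by rewrite e2 nth_cat ltnNge leqnSn subSnn.
have [s path_s last_s] := root_path_to x.
apply/containsP; exists (rcons (rcons s y) z).
  by rewrite !rcons_path path_s last_s xy last_rcons.
by rewrite -!cats1 -catA pairmap_cat /= last_s suffix_infix.
Qed.
End RootPaths.

(** * Labellings *)

Section Labellings.
Variable n : nat.
Local Notation point := 'I_n.+1.
Implicit Types (x y : point) (f g : {ffun point -> 'I_n.+2}) (A : {set 'I_n}).

(** Labels start at 1 and grow by at most 1, so this set determines the labelling; [labelling_of]
    shows that every set occurs. *)
Definition levels f : {set 'I_n} :=
  [set i : 'I_n | f (inord i) == f (inord i.+1)].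

Lemma labelling_leq f x y : is_labelling f -> x <= y -> f x <= f y.
Proof.
by case/and3P=> /forallP/(_ x)/forallP/(_ y)/implyP mono _ _; exact: mono.
Qed.

(** A larger jump would leave the label after [f (inord i)] unattained, by monotonicity. *)
Lemma labelling_succ f i : is_labelling f -> i < n ->
  f (inord i.+1) <= (f (inord i)).+1.
Proof.
move=> lab lt_i; have mono u v := @labelling_leq f u v lab.
have /and3P[_ _ /existsP[m /forallP codf]] := lab.
rewrite leqNgt; apply/negP=> jump.
have := codf (f (inord i.+1)); rewrite codom_f => /eqP/esym/andP[_ le_m].
have lt_l : (f (inord i)).+1 < n.+2 by apply: leq_ltn_trans (ltn_ord m); lia.
have /eqP := codf (Ordinal lt_l).
have -> : 1 <= Ordinal lt_l <= m by rewrite /=; lia.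
case/codomP=> x /(congr1 val) /= Ex.
case: (leqP x i) => hx.
  have := mono x (inord i); rewrite inordK; lia.
have := mono (inord i.+1) x; rewrite inordK; lia.
Qed.

Lemma levels_inj f g : is_labelling f -> is_labelling g ->
  levels f = levels g -> f = g.
Proof.
move=> lf lg /setP eq_lev; apply/ffunP=> x; apply: ord_inj.
rewrite -(inord_val x); elim: (x : nat) (ltn_ord x) => [|i IHi] lt_i.
  have -> : inord 0 = ord0 :> point by apply: ord_inj; rewrite inordK.
  by case/and3P: lf => _ /eqP-> _; case/and3P: lg => _ /eqP-> _.
have : (f (inord i) == f (inord i.+1) :> nat)
     = (g (inord i) == g (inord i.+1) :> nat).
  by have := eq_lev (Ordinal (lt_i : i < n)); rewrite !inE.
have := IHi (ltnW lt_i).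
have := labelling_succ lf (lt_i : i < n); have := labelling_succ lg (lt_i : i < n).
have lei : (inord i : point) <= (inord i.+1 : point) by rewrite !inordK //; lia.
have := labelling_leq lf lei; have := labelling_leq lg lei.
move: (nat_of_ord (f (inord i))) (nat_of_ord (f (inord i.+1))).
move: (nat_of_ord (g (inord i))) (nat_of_ord (g (inord i.+1))) ; lia.
Qed.

Definition label_of A k := (\sum_(0 <= i < k) (i \notin [seq val j | j in A])).+1.

Lemma label_of_succ A k :
  label_of A k.+1 = label_of A k + (k \notin [seq val j | j in A]).
Proof. by rewrite /label_of big_nat_recr //= addSn. Qed.

Lemma label_of_lt A k : label_of A k <= k.+1.
Proof.
elim: k => [|k IHk]; first by rewrite /label_of big_geq.
rewrite label_of_succ; lia.
Qed.

Lemma label_of_mono A : {homo label_of A : i j / i <= j}.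
Proof.
apply: homo_leq => // [|i]; first exact: leq_trans.
by rewrite label_of_succ leq_addr.
Qed.

Definition labelling_of A : {ffun point -> 'I_n.+2} :=
  [ffun x : point => inord (label_of A x)].

Lemma labelling_ofE A x : labelling_of A x = label_of A x :> nat.
Proof.
by rewrite ffunE inordK // ltnS; apply: leq_trans (label_of_lt _ _) (ltn_ord x).
Qed.

Lemma labelling_of_is A : is_labelling (labelling_of A).
Proof.
apply/and3P; split.
- apply/forallP=> x; apply/forallP=> y; apply/implyP=> le_xy.
  by rewrite !labelling_ofE label_of_mono.
- by rewrite labelling_ofE /label_of big_geq.
apply/existsP; exists (labelling_of A ord_max); apply/forallP=> l.
apply/eqP; apply/idP/idP => [/codomP[x ->]|].
  rewrite !labelling_ofE label_of_mono ?andbT; first by [].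
  by rewrite -ltnS.
rewrite labelling_ofE /= => /andP[l_gt0].
suff gen k : k <= n -> l <= label_of A k -> l \in codom (labelling_of A).
  exact: gen.
elim: k => [|k IHk] le_k le_l.
  apply/codomP; exists ord0; apply: ord_inj; apply/eqP.
  rewrite eqn_leq labelling_ofE le_l; apply: leq_trans l_gt0.
  exact: label_of_lt.
have [le|gt] := leqP l (label_of A k); first by apply: IHk => //; lia.
apply/codomP; exists (inord k.+1); apply: ord_inj.
apply/eqP; rewrite eqn_leq labelling_ofE inordK // le_l label_of_succ.
by apply: leq_trans gt; rewrite -addn1 leq_add2l leq_b1.
Qed.

Lemma levels_labelling_of A : levels (labelling_of A) = A.
Proof.
apply/setP=> i; rewrite inE -(inj_eq val_inj) /= !labelling_ofE.
have lt_i := ltn_ord i.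
rewrite !inordK ?label_of_succ; [|lia..].
rewrite (mem_map val_inj) mem_enum -[X in X == _]addn0 eqn_add2l.
by case: (i \in A).
Qed.

Lemma card_labellings A :
  #|[set f | is_labelling f & levels f \subset A]| = 2 ^ #|A|.
Proof.
rewrite -card_powerset -(card_in_imset (f := levels)); last first.
  by move=> f g; rewrite !inE => /andP[lf _] /andP[lg _]; exact: levels_inj.
apply: eq_card => B; rewrite powersetE; apply/imsetP/idP.
  by case=> f; rewrite inE => /andP[_ sub] ->.
move=> sub; exists (labelling_of B); rewrite ?levels_labelling_of //.
by rewrite inE labelling_of_is levels_labelling_of.
Qed.
End Labellings.

(** * Avoidance *)

Section Avoidance.
Variables (n : nat) (p d : nat -> nat) (f : {ffun 'I_n.+1 -> 'I_n.+2}).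
Hypothesis pm : parent_map n p d.
Hypothesis lab : is_labelling f.
Local Notation point := 'I_n.+1.
Local Notation T := ((edges n p, f) : gnc_type n).
Implicit Types x y z : point.

Definition strict := forall x y, child p x y -> f x != f y :> nat.

Lemma step_strict x y : f x != f y :> nat ->
  edge_step f x y = if x < y then Up else Down.
Proof.
move=> ne; rewrite /edge_step /step_of (negbTE ne).
case: (ltnP x y) => hxy; have := labelling_leq lab; last first.
  by move=> /(_ _ _ hxy); rewrite leqNgt => /negbTE->.
by move=> /(_ _ _ (ltnW hxy)); rewrite leq_eqVlt (negbTE ne) /= => ->.
Qed.

Lemma avoids_level : ~~ contains T [:: Level] <-> strict.
Proof.
split=> [avo x y xy|str].
  apply: contraNneq avo => eq_f; apply/(contains1 f pm).
  by exists x, y; split=> //; rewrite /edge_step /step_of eq_f ltnn eqxx.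
apply/negP => /(contains1 f pm)[x [y [xy]]].
by rewrite step_strict ?str //; case: ifP.
Qed.

(** The booleans let one statement serve both [ud] and [du]. *)
Lemma avoids_pair (a b : bool) : strict ->
  ~~ contains T [:: if a then Up else Down; if b then Up else Down] <->
  forall x y z, child p x y -> child p y z ->
    ~~ (((x < y) == a) && ((y < z) == b)).
Proof.
move=> str; split=> [avo x y z xy yz|ok].
  apply: contraNN avo => /andP[/eqP<- /eqP<-]; apply/(contains2 f pm).
  by exists x, y, z; split=> //; rewrite step_strict // str.
apply/negP => /(contains2 f pm)[x [y [z [xy yz]]]].
rewrite !step_strict ?str // => ea eb; have := ok _ _ _ xy yz.
have step_inj (c e : bool) :
    (if c then Up else Down) = (if e then Up else Down) -> c = e.
  by case: c; case: e.
by rewrite (step_inj _ _ ea) (step_inj _ _ eb) !eqxx.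
Qed.
End Avoidance.

(** * Crossings and forbidden words in terms of the parent map *)

Section FitEdges.
Variables (n : nat) (p d : nat -> nat).
Hypothesis pm : parent_map n p d.
Local Notation point := 'I_n.+1.
Implicit Types x y z : point.

Lemma pointP v : 0 < v <= n -> exists2 y : point, y != ord0 & y = v :> nat.
Proof.
case/andP=> v_gt0 v_le; exists (inord v); last by rewrite inordK.
by rewrite -(inj_eq val_inj) /= inordK // -lt0n.
Qed.

Lemma point_gt0 y : (y != ord0) = (0 < y).
Proof. by rewrite -(inj_eq val_inj) -lt0n. Qed.

Lemma noncrossing_parent :
  noncrossing (edges n p) <->
  forall u v, 0 < u <= n -> 0 < v <= n -> ~~ crossing p u v.
Proof.
rewrite (noncrossing_edges pm); split=> [nc u v|nc u v u0 v0].
  by move=> /pointP[x x0 <-] /pointP[y y0 <-]; apply: nc.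
by apply: nc; rewrite -point_gt0 ?u0 ?v0 /= -ltnS ltn_ord.
Qed.

Lemma no_down_upP :
  (forall x y z, child p x y -> child p y z ->
     ~~ (((x < y) == false) && ((y < z) == true)))
  <-> forall v, 0 < v <= n -> 0 < p v -> ~~ down_up p v.
Proof.
rewrite /down_up; split=> [avo v /pointP[z z0 <-] pz|avo x y z].
  have yz := child_inord pm z0; have Ey := inord_parent pm z0.
  set y : point := inord (p z) in yz Ey.
  have y0 : y != ord0 by rewrite point_gt0 Ey.
  have xy := child_inord pm y0; have Ex := inord_parent pm y0.
  have := avo _ _ _ xy yz; have := child_rank pm xy; rewrite Ex Ey.
  case: (ltngtP (p (p z)) (p z)) => [||->]; rewrite ?ltnn //; lia.
move=> xy; have := child_rank pm xy; case/andP: xy => [y0 /eqP Ex].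
move=> rk /andP[z0 /eqP Ey]; rewrite !point_gt0 in y0 z0.
have ne : p y != y by apply: contraTneq rk => Epy; rewrite -Ex Epy ltnn.
have := avo z; rewrite -Ex -Ey in y0 ne *; have := ltn_ord z; lia.
Qed.

(** The root has the smallest index, so each path starts with an up step; avoiding [ud], all later
    steps go up too. *)
Lemma no_up_downP :
  (forall x y z, child p x y -> child p y z ->
     ~~ (((x < y) == true) && ((y < z) == false)))
  <-> forall v, 0 < v <= n -> p v < v.
Proof.
split=> [avo|up x y z _ /andP[z0 /eqP Ey]]; last first.
  by rewrite -Ey up ?andbF // -point_gt0 z0 /= -ltnS ltn_ord.
suff up y : forall x, child p x y -> x < y.
  by move=> v /pointP[y y0 <-]; rewrite -(inord_parent pm y0) up // (child_inord pm).
elim/(rank_ind pm): y => [x /andP[]|y z yz IHy x xz]; first by rewrite eqxx.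
rewrite (child_uniq xz yz); have [->|y0] := eqVneq y ord0.
  by rewrite -point_gt0; case/andP: yz.
have xy := child_inord pm y0.
by have := avo _ _ _ xy yz; rewrite (IHy _ xy) /=; case: ltnP.
Qed.
End FitEdges.

(** * The tree of a shape and its labellings *)

Section TreeEdges.
Variables (n : nat) (t : ltree).
Hypothesis size_t : lsize t = n.
Local Notation p := (lparent 0 t).
Local Notation point := 'I_n.+1.
Implicit Types x y z : point.

Let fit_t : lfit p 0 t. Proof. exact: lfit_lparent. Qed.

(* As [du] is avoided, only up steps precede an up step on a root path, so the
   vertices entered by an up step can be ranked by their index; those entered
   by a down step come after them, by decreasing index. *)
Definition tree_rank v :=
  if p v < v then v else if v == 0 then 0 else n.*2 - v + 1.

Lemma parent_map_tree : parent_map n p tree_rank.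
Proof.
move=> v hv.
have bnd u := lfit_bounds (v := u) fit_t; have du u := lfit_down_up (v := u) fit_t.
move: (bnd v) (bnd (p v)) (du v).
rewrite /tree_rank /down_up size_t !add0n => bv bpv dv.
case: (ltnP (p v) v) => h1; case: (ltnP (p (p v)) (p v)) => h2 /=;
  case: (eqVneq (p v) 0) => [E|?]; case: (eqVneq v 0) => ? /=; lia.
Qed.

Definition nonadjacent_gaps : {set 'I_n} := [set i : 'I_n | ~~ short_gap p 0 i].

Lemma card_nonadjacent_gaps : #|nonadjacent_gaps| = lgaps t.
Proof.
rewrite -(lgapsE fit_t) size_t add0n big_mkord -sum1dep_card big_mkcond /=.
by apply: eq_bigr => i _; case: short_gap.
Qed.

(** An edge between consecutive points forbids a level there. Conversely, by [lfit_gap] every chord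
    spans such an edge, where the label increases. *)
Lemma strict_labelling f : is_labelling f ->
  strict p f <-> levels f \subset nonadjacent_gaps.
Proof.
move=> lab; split=> [str|/subsetP sub x y].
  apply/subsetP=> i; rewrite !inE => /eqP eq_f; apply/negP => gap_i.
  have lt_i := ltn_ord i.
  have Ei : (inord i : point) = i :> nat by rewrite inordK //; lia.
  have Ei1 : (inord i.+1 : point) = i.+1 :> nat by rewrite inordK //; lia.
  case/orP: gap_i => [Ep|/andP[i_gt0 Ep]].
    have /str : child p (inord i : point) (inord i.+1).
      by rewrite /child /= -(inj_eq val_inj) /= Ei Ei1 Ep.
    by rewrite eq_f eqxx.
  have /str : child p (inord i.+1 : point) (inord i).
    by rewrite /child /= -(inj_eq val_inj) /= Ei Ei1 Ep -lt0n i_gt0.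
  by rewrite eq_f eqxx.
case/andP=> y0 /eqP Ex; have lt_y := ltn_ord y.
have [|i hi gap_i] := lfit_gap (v := y) fit_t; first by rewrite -point_gt0 y0; lia.
move: hi; rewrite /chord_min /chord_max Ex => hi.
have lt_i : i < n by have := ltn_ord x; lia.
have : Ordinal lt_i \notin levels f.
  by apply: contraL gap_i => /sub; rewrite inE.
rewrite inE /= => ne_f.
have mono u v := @labelling_leq n f u v lab.
have lt_f : f (inord i) < f (inord i.+1).
  rewrite ltn_neqAle ne_f mono // !inordK //; lia.
have [le|le] := leqP x y.
  have := mono x (inord i); have := mono (inord i.+1) y; rewrite !inordK; lia.
have := mono y (inord i); have := mono (inord i.+1) x; rewrite !inordK; lia.
Qed.
End TreeEdges.

(** * Encoding by shapes *)

Section Characterisation.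
Variable n : nat.
Local Notation point := 'I_n.+1.
Implicit Types (T : gnc_type n) (t : ltree).

Definition tree_edges t := edges n (lparent 0 t).

Definition encoded_by T t :=
  [&& T.1 == tree_edges t, is_labelling T.2
    & levels T.2 \subset nonadjacent_gaps n t].

Lemma edges_ext p q : (forall v, 0 < v <= n -> p v = q v) ->
  edges n p = edges n q.
Proof.
move=> pq; apply/setP=> A; apply/imsetP/imsetP => -[v v0 ->]; exists v => //;
  by rewrite inE point_gt0 in v0; rewrite pq // v0 -ltnS ltn_ord.
Qed.

(** Induction from the root: were an edge oriented differently by the two maps, its ends would be
    parents of each other under [p], against the rank. *)
Lemma edges_inj p q d e : parent_map n p d -> parent_map n q e ->
  edges n p = edges n q -> forall v, 0 < v <= n -> p v = q v.
Proof.
move=> pm qm eq_E.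
suff eq_pq (y : point) : y != ord0 -> p y = q y.
  by move=> v /pointP[y y0 <-]; apply: eq_pq.
elim/(rank_ind pm): y => [|x y xy IHx y0]; first by rewrite eqxx.
have /andP[_ /eqP Ex] := xy.
have : adj (edges n q) x y by rewrite -eq_E (adj_edges pm) xy.
rewrite (adj_edges qm) => /orP[/andP[_ /eqP->]//|/andP[x0 /eqP Ey]].
have /(child_rank pm) : child p y x by rewrite /child /= x0 IHx // Ey eqxx.
have := child_rank pm xy; lia.
Qed.

Lemma tree_edges_inj t t' : lsize t = n -> lsize t' = n ->
  tree_edges t = tree_edges t' -> t = t'.
Proof.
move=> st st' eq_E.
have eq_p := edges_inj (parent_map_tree st) (parent_map_tree st') eq_E.
apply: (lfit_inj (p := lparent 0 t) (a := 0)); [exact: lfit_lparent| |lia].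
by apply: lfit_ext (lfit_lparent 0 t') => v va; rewrite eq_p //; lia.
Qed.

Lemma GNC_parent P T : T \in GNC n P -> exists p d,
  [/\ parent_map n p d, T = (edges n p, T.2), is_labelling T.2,
      forall u v, 0 < u <= n -> 0 < v <= n -> ~~ crossing p u v & avoids T P].
Proof.
case: T => E f; rewrite inE => /andP[/and3P[/= treeE ncE lab] avo].
have [p [d [pm Ep]]] := tree_parent treeE; exists p, d; split=> //.
  by rewrite Ep.
by apply/(noncrossing_parent pm); rewrite -Ep.
Qed.

Lemma parent_encoded p d f : parent_map n p d -> is_labelling f -> strict p f ->
  (forall u v, 0 < u <= n -> 0 < v <= n -> ~~ crossing p u v) ->
  (forall v, 0 < v <= n -> 0 < p v -> ~~ down_up p v) ->
  exists t, [/\ lsize t = n, lfit p 0 t & encoded_by (edges n p, f) t].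
Proof.
move=> pm lab str nc du.
have [|||t size_t fit_t] := @lfit_exists p 0 n; rewrite ?add0n //.
  move=> v hv; have /andP[-> rk] := pm _ hv.
  by apply: contraTneq rk => ->; rewrite ltnn.
have eq_p v : 0 < v <= n -> p v = lparent 0 t v.
  by move=> hv; apply: lfit_lparentE; rewrite ?size_t.
exists t; split=> //; rewrite /encoded_by /= /tree_edges (edges_ext eq_p) eqxx lab.
apply/(strict_labelling size_t lab) => x y /andP[y0 yx]; apply: str.
by rewrite /child /= y0 eq_p // -point_gt0 y0 -ltnS ltn_ord.
Qed.

Lemma encoded_GNC T t (a b : bool) : lsize t = n -> encoded_by T t ->
  (forall x y z : point, child (lparent 0 t) x y -> child (lparent 0 t) y z ->
     ~~ (((x < y) == a) && ((y < z) == b))) ->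
  T \in GNC n [:: [:: if a then Up else Down; if b then Up else Down];
                [:: Level]].
Proof.
case: T => E f size_t /and3P[/= /eqP-> lab lev] ok.
have pm := parent_map_tree size_t; have fit_t := lfit_lparent 0 t.
have str : strict (lparent 0 t) f by apply/(strict_labelling size_t lab).
rewrite inE /is_gnc /= (is_tree_edges pm) lab andbT /=.
apply/andP; split.
  apply/(noncrossing_parent pm) => u v hu hv.
  by apply: (lfit_noncrossing fit_t); rewrite ?size_t ?add0n.
rewrite andbT; apply/andP; split; first exact/(avoids_pair pm lab).
exact/(avoids_level pm lab).
Qed.

Lemma GNC_du T : T \in GNC n [:: [:: Down; Up]; [:: Level]] <->
  exists2 t, lsize t = n & encoded_by T t.
Proof.
split=> [inT|[t size_t enc]].
  have [p [d [pm -> lab nc]]] := GNC_parent inT.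
  rewrite /avoids /= andbT => /andP[av1 av2].
  have str : strict p T.2 by apply/(avoids_level pm lab).
  have [|t [size_t _ enc]] := parent_encoded pm lab str nc; last by exists t.
  by apply/(no_down_upP pm); exact/(avoids_pair pm lab false true).
apply: (encoded_GNC (a := false) (b := true) size_t enc).
apply/(no_down_upP (parent_map_tree size_t)) => v hv.
by apply: (lfit_down_up (lfit_lparent 0 t)); rewrite size_t.
Qed.

Lemma GNC_ud T : T \in GNC n [:: [:: Up; Down]; [:: Level]] <->
  exists2 t, dsize t = n & encoded_by T (up_tree t).
Proof.
split=> [inT|[t size_t enc]].
  have [p [d [pm -> lab nc]]] := GNC_parent inT.
  rewrite /avoids /= andbT => /andP[av1 av2].
  have str : strict p T.2 by apply/(avoids_level pm lab).
  have up : forall v, 0 < v <= n -> p v < v.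
    by apply/(no_up_downP pm); exact/(avoids_pair pm lab true false).
  have [|t [size_t fit_t enc]] := parent_encoded pm lab str nc.
    move=> v hv pv; rewrite /down_up; have := up v hv; have := up (p v); lia.
  have [|t' Et] := (up_treeP fit_t).1; first by move=> v; rewrite size_t; apply: up.
  by exists t'; rewrite -?Et // -lsize_up_tree -Et.
have size_ut : lsize (up_tree t) = n by rewrite lsize_up_tree.
apply: (encoded_GNC (a := true) (b := false) size_ut enc).
apply/(no_up_downP (parent_map_tree size_ut)) => v hv.
by apply: (up_treeP (lfit_lparent 0 (up_tree t))).2; [exists t | rewrite size_ut].
Qed.

(** Trees are grouped by edge set. Distinct shapes have distinct edge sets, and [card_labellings]
    counts the labellings over each. *)
Lemma card_encoded P (ts : seq ltree) : uniq ts ->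
  {in ts, forall t, lsize t = n} ->
  (forall T, T \in GNC n P <-> exists2 t, t \in ts & encoded_by T t) ->
  #|GNC n P| = \sum_(t <- ts) 2 ^ lgaps t.
Proof.
move=> uniq_ts size_ts GNC_P.
pose fibre E := [set f | (E, f) \in GNC n P].
have in_fibre E f : (f \in fibre E) = ((E, f) \in GNC n P) by exact: in_set.
have -> : #|GNC n P| = \sum_E #|fibre E|.
  rewrite -sum1_card big_mkcond /=.
  pose member E f := if (E, f) \in GNC n P then 1 else 0.
  rewrite (eq_bigr (fun T => member T.1 T.2)); last by case.
  rewrite -(pair_bigA _ member) /=.
  apply: eq_bigr => E _; rewrite -sum1_card [RHS]big_mkcond /=.
  by apply: eq_bigr => f _; rewrite in_fibre.
have uniq_E : uniq (map tree_edges ts).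
  rewrite map_inj_in_uniq // => t t' /size_ts st /size_ts st'.
  exact: tree_edges_inj.
transitivity (\sum_(E <- map tree_edges ts) #|fibre E|).
  rewrite [RHS]big_uniq // [RHS]big_mkcond /=; apply: eq_bigr => E _.
  case: ifPn => // /negP nE; apply/eqP; rewrite cards_eq0 -subset0.
  apply/subsetP=> f; rewrite in_fibre => /GNC_P[t t_in /and3P[/eqP/= E_t _ _]].
  by case: nE; apply/mapP; exists t.
rewrite big_map big_seq [RHS]big_seq; apply: eq_bigr => t t_in.
rewrite -(card_nonadjacent_gaps (size_ts _ t_in)) -card_labellings.
apply: eq_card => f; rewrite in_fibre [RHS]in_set.
apply/idP/idP => [/GNC_P[t' t'_in /and3P[/= /eqP eq_t lab lev]]|/andP[lab lev]].
  by rewrite lab (tree_edges_inj _ _ eq_t) ?size_ts.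
by apply/GNC_P; exists t; rewrite // /encoded_by /= eqxx lab lev.
Qed.

End Characterisation.

(** * Enumeration of the shapes by height *)

Fixpoint dtrees h :=
  if h is h'.+1 then
    DLeaf :: [seq DNode C A | C <- dtrees h', A <- dtrees h'] else [:: DLeaf].

Fixpoint ltrees h :=
  if h is h'.+1 then
    LLeaf :: [seq LNode AB.1 AB.2 C
               | AB <- [seq (A, B) | A <- ltrees h', B <- dtrees h'],
                 C <- ltrees h']
  else [:: LLeaf].

Lemma dtrees_uniq h : uniq (dtrees h).
Proof.
elim: h => //= h IHh; apply/andP; split.
  by apply/allpairsP => -[[C A] []].
by apply: allpairs_uniq => // -[C A] [C' A'] _ _ [-> ->].
Qed.

Lemma ltrees_uniq h : uniq (ltrees h).
Proof.
elim: h => //= h IHh; apply/andP; split.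
  by apply/allpairsP => -[[AB C] []].
apply: allpairs_uniq => //; last first.
  by move=> [[A B] C] [[A' B'] C'] _ _ /= [-> -> ->].
by apply: allpairs_uniq; rewrite ?dtrees_uniq // => -[A B] [A' B'] _ _ [-> ->].
Qed.

(** The height of a shape is at most its size. *)
Lemma mem_dtrees h t : dsize t <= h -> t \in dtrees h.
Proof.
elim: h t => [|h IHh] [|C A] //= size_t; rewrite inE.
by apply/allpairsP; exists (C, A); split=> //=; apply: IHh; lia.
Qed.

Lemma mem_ltrees h t : lsize t <= h -> t \in ltrees h.
Proof.
elim: h t => [|h IHh] [|A B C] //= size_t; rewrite inE.
apply/allpairsP; exists ((A, B), C); split=> //=; last by apply: IHh; lia.
apply/allpairsP; exists (A, B); split=> //=; first by apply: IHh; lia.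
by apply: mem_dtrees; lia.
Qed.

Lemma card_GNC_du n : #|GNC n [:: [:: Down; Up]; [:: Level]]| =
  \sum_(t <- ltrees n | lsize t == n) 2 ^ lgaps t.
Proof.
rewrite -big_filter; apply: card_encoded.
- by rewrite filter_uniq // ltrees_uniq.
- by move=> t; rewrite mem_filter => /andP[/eqP].
move=> T; rewrite GNC_du; split=> -[t size_t enc]; exists t => //.
  by rewrite mem_filter size_t eqxx mem_ltrees ?size_t.
by move: size_t; rewrite mem_filter => /andP[/eqP].
Qed.

Lemma card_GNC_ud n : #|GNC n [:: [:: Up; Down]; [:: Level]]| =
  \sum_(t <- dtrees n | dsize t == n) 2 ^ dgaps t.
Proof.
under eq_bigr do rewrite -lgaps_up_tree.
rewrite -big_filter -(big_map up_tree xpredT (fun t => 2 ^ lgaps t)).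
have up_inj : injective up_tree.
  by elim=> [|C IHC A IHA] [|C' A'] //= [/IHA-> /IHC->].
apply: card_encoded.
- by rewrite map_inj_uniq // filter_uniq // dtrees_uniq.
- by move=> _ /mapP[t + ->]; rewrite mem_filter lsize_up_tree => /andP[/eqP].
move=> T; rewrite GNC_ud; split=> [[t size_t enc]|[_ /mapP[t + ->] enc]].
  exists (up_tree t) => //; apply: map_f.
  by rewrite mem_filter size_t eqxx mem_dtrees ?size_t.
by rewrite mem_filter => /andP[/eqP]; exists t.
Qed.

(** * Generating series modulo a power of the variable *)

Local Open Scope ring_scope.

Implicit Types (p q r : {poly rat}) (N : nat).

Definition eqX N p q := 'X^N %| p - q.

Lemma eqX_refl N p : eqX N p p.
Proof. by rewrite /eqX subrr dvdp0. Qed.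

Lemma eqX_sym N p q : eqX N p q -> eqX N q p.
Proof. by rewrite /eqX -opprB dvdpNr. Qed.

Lemma eqX_trans N q p r : eqX N p q -> eqX N q r -> eqX N p r.
Proof. by move=> pq qr; rewrite /eqX -(subrKA q) dvdp_add. Qed.

Lemma eqXD N p q p' q' : eqX N p q -> eqX N p' q' -> eqX N (p + p') (q + q').
Proof. by move=> pq pq'; rewrite /eqX opprD addrACA dvdp_add. Qed.

Lemma eqXM N p q p' q' : eqX N p q -> eqX N p' q' -> eqX N (p * p') (q * q').
Proof.
move=> pq pq'; rewrite /eqX.
have -> : p * p' - q * q' = (p - q) * p' + q * (p' - q') by ring.
by apply: dvdp_add; [apply: dvdp_mulr | apply: dvdp_mull].
Qed.

Lemma eqXMl N r p q : eqX N p q -> eqX N (r * p) (r * q).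
Proof. exact/eqXM/eqX_refl. Qed.

Lemma eqX_exp N p q i : eqX N p q -> eqX N (p ^+ i) (q ^+ i).
Proof.
move=> pq; elim: i => [|i IHi]; first exact: eqX_refl.
by rewrite !exprS; apply: eqXM.
Qed.

Lemma eqX_sum N (I : Type) (s : seq I) (F G : I -> {poly rat}) :
  (forall i, eqX N (F i) (G i)) -> eqX N (\sum_(i <- s) F i) (\sum_(i <- s) G i).
Proof.
by move=> FG; rewrite /eqX -sumrB; apply: (big_ind (fun x => 'X^N %| x));
  [exact: dvdp0 | exact: dvdp_add | move=> i _; exact: FG].
Qed.

Lemma eqX_mulX N p q : eqX N p q -> eqX N.+1 ('X * p) ('X * q).
Proof. by rewrite /eqX -mulrBr exprS => pq; rewrite dvdp_mul2l ?polyX_eq0. Qed.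

Lemma eqXW N M p q : (M <= N)%N -> eqX N p q -> eqX M p q.
Proof. by move=> MN; apply: dvdp_trans; rewrite dvdp_exp2l. Qed.

Lemma eqX_coef N p q i : eqX N p q -> (i < N)%N -> p`_i = q`_i.
Proof.
case/dvdpP=> r pq lt_i; apply/eqP; rewrite -subr_eq0 -coefB pq coefMXn lt_i.
by [].
Qed.

Lemma coef_eqX N p q : (forall i, (i < N)%N -> p`_i = q`_i) -> eqX N p q.
Proof.
move=> pq; apply/dvdpP; exists (drop_poly N (p - q)).
rewrite -[LHS](poly_take_drop N) [take_poly _ _](_ : _ = 0) ?add0r //.
apply/polyP=> i; rewrite coef_take_poly coef0 coefB.
by case: ltnP => // /pq->; rewrite subrr.
Qed.

Lemma eqX_comp N p q r : eqX N p q -> 'X %| r -> eqX N (p \Po r) (q \Po r).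
Proof.
case/dvdpP=> w pq Xr; rewrite /eqX -comp_polyB pq comp_polyM comp_Xn_poly.
by rewrite dvdp_mull // dvdp_exp2r.
Qed.

Lemma eqX_cancel N p q r : r`_0 != 0 -> eqX N (r * p) (r * q) -> eqX N p q.
Proof.
move=> r0; rewrite /eqX -mulrBr Gauss_dvdpr // coprimep_expl //.
by rewrite coprimep_sym coprimepX /root horner_coef0.
Qed.

(** * Functional equations of the weighted series *)

Definition dterm t : {poly rat} := (2 ^ dgaps t)%:R *: 'X^(dsize t).
Definition lterm t : {poly rat} := (2 ^ lgaps t)%:R *: 'X^(lsize t).

Definition dpoly h := \sum_(t <- dtrees h) dterm t.

Definition lpoly h := \sum_(t <- ltrees h) lterm t.

Lemma coef_dpoly h n :
  (dpoly h)`_n = (\sum_(t <- dtrees h | dsize t == n) 2 ^ dgaps t)%:R.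
Proof.
rewrite coef_sum natr_sum [RHS]big_mkcond; apply: eq_bigr => t _.
by rewrite coefZ coefXn eq_sym; case: eqP; rewrite ?mulr1 ?mulr0.
Qed.

Lemma coef_lpoly h n :
  (lpoly h)`_n = (\sum_(t <- ltrees h | lsize t == n) 2 ^ lgaps t)%:R.
Proof.
rewrite coef_sum natr_sum [RHS]big_mkcond; apply: eq_bigr => t _.
by rewrite coefZ coefXn eq_sym; case: eqP; rewrite ?mulr1 ?mulr0.
Qed.

Lemma sum_dleaf h : \sum_(t <- dtrees h) (dsize t == 0%N)%:R = 1 :> {poly rat}.
Proof.
case: h => [|h] /=; first by rewrite big_seq1.
rewrite big_cons big_allpairs_dep /= big1 ?addr0 // => C _.
by rewrite big1.
Qed.

Lemma sum_lleaf h : \sum_(t <- ltrees h) (lsize t == 0%N)%:R = 1 :> {poly rat}.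
Proof.
case: h => [|h] /=; first by rewrite big_seq1.
rewrite big_cons big_allpairs_dep /= big1 ?addr0 // => C _.
by rewrite big1.
Qed.

(** The new gap contributes a factor 2 unless [A] is a point; in that case [dterm A = 1] and the
    correction leaves [2 - 1]. By [sum_dleaf] the corrections add up to 1, whence the factor
    [2 D - 1]. *)
Lemma dtermS C A :
  dterm (DNode C A) = 'X * ((2%:R * dterm A - (dsize A == 0%N)%:R) * dterm C).
Proof.
rewrite /dterm /= -!mul_polyC exprS exprD !expnD !natrM !polyCM.
case: A => [|A1 A2] /=; first by rewrite expr0 expn0; ring.
by rewrite expn1 !polyC_natr; ring.
Qed.

Lemma ltermS A B C : lterm (LNode A B C) = 'X *
  ((2%:R * (lterm A * dterm B) - (lsize A == 0%N)%:R * (dsize B == 0%N)%:R)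
   * lterm C).
Proof.
rewrite /lterm /dterm /= -!mul_polyC exprS !exprD !expnD !natrM !polyCM.
case: A => [|A1 A2 A3] /=; case: B => [|B1 B2] /=;
  rewrite ?expr0 ?expn0 ?expn1 ?addn0 ?add0n ?expn1 !polyC_natr; ring.
Qed.

Lemma dpolyS h : dpoly h.+1 = 1 + 'X * ((2%:R * dpoly h - 1) * dpoly h).
Proof.
rewrite {1}/dpoly big_cons {1}/dterm /= expr0 scale1r big_allpairs_dep /=.
congr (_ + _); rewrite -[X in _ - X](sum_dleaf h) /dpoly [2%:R * _]mulr_sumr -sumrB.
rewrite big_distrlr /= mulr_sumr exchange_big /=.
by apply: eq_bigr => A _; rewrite mulr_sumr; apply: eq_bigr => C _; rewrite -dtermS.
Qed.

Lemma lpolyS h :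
  lpoly h.+1 = 1 + 'X * ((2%:R * (lpoly h * dpoly h) - 1) * lpoly h).
Proof.
rewrite {1}/lpoly big_cons {1}/lterm /= expr0 scale1r !big_allpairs_dep /=.
congr (_ + _); rewrite -[X in _ - X]mulr1 -[X in _ - X * _](sum_lleaf h).
rewrite -[X in _ - _ * X](sum_dleaf h) /lpoly /dpoly !big_distrlr /=.
rewrite [2%:R * _]mulr_sumr -sumrB mulr_suml mulr_sumr; apply: eq_bigr => A _.
rewrite [2%:R * _]mulr_sumr -sumrB mulr_suml mulr_sumr; apply: eq_bigr => B _.
by rewrite !mulr_sumr; apply: eq_bigr => C _; rewrite -ltermS.
Qed.

(** The factor ['X] in [dpolyS] makes each iteration correct one more coefficient. *)
Lemma dpoly_stable h : eqX h.+1 (dpoly h.+1) (dpoly h).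
Proof.
elim: h => [|h IHh].
  rewrite dpolyS /dpoly /= big_seq1 /lterm /dterm expr0 scale1r /eqX.
  have -> : 1 + 'X * ((2%:R * 1 - 1) * 1) - 1 = 'X^1 :> {poly rat} by ring.
  exact: dvdpp.
rewrite dpolyS [X in eqX _ _ X]dpolyS; apply/eqXD/eqX_mulX; first exact: eqX_refl.
by apply: eqXM => //; apply: eqXD (eqX_refl _ _); apply: eqXMl.
Qed.

Lemma lpoly_stable h : eqX h.+1 (lpoly h.+1) (lpoly h).
Proof.
elim: h => [|h IHh].
  rewrite lpolyS /lpoly /dpoly /= !big_seq1 /lterm /dterm expr0 scale1r /eqX.
  have -> : 1 + 'X * ((2%:R * (1 * 1) - 1) * 1) - 1 = 'X^1 :> {poly rat} by ring.
  exact: dvdpp.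
rewrite lpolyS [X in eqX _ _ X]lpolyS; apply/eqXD/eqX_mulX; first exact: eqX_refl.
apply: eqXM => //; apply: eqXD (eqX_refl _ _); apply: eqXMl.
exact/eqXM/dpoly_stable.
Qed.

Lemma dpoly_eq h :
  eqX h.+1 ((1 + 'X) * dpoly h) (1 + 2%:R * 'X * dpoly h ^+ 2).
Proof.
have := dpoly_stable h; rewrite dpolyS /eqX -dvdpNr; congr (_ %| _); ring.
Qed.

Lemma lpoly_eq h :
  eqX h.+1 ((1 + 'X) * lpoly h) (1 + 2%:R * 'X * dpoly h * lpoly h ^+ 2).
Proof.
have := lpoly_stable h; rewrite lpolyS /eqX -dvdpNr; congr (_ %| _); ring.
Qed.

(** The difference of the two equations is [p - q] times a factor with constant term 1, which
    cancels. *)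
Lemma quadratic_uniq N c p q : 
  eqX N ((1 + 'X) * p) (1 + 'X * c * p ^+ 2) ->
  eqX N ((1 + 'X) * q) (1 + 'X * c * q ^+ 2) -> eqX N p q.
Proof.
move=> Ep Eq; apply: (@eqX_cancel _ _ _ (1 + 'X * (1 - c * (p + q)))).
  by rewrite coefD coef1 coefXM addr0 oner_eq0.
have := dvdp_sub Ep Eq; rewrite /eqX; congr (_ %| _); ring.
Qed.

(** With [r] the truncated root, [p * p] and [r * r] agree, and [p + r] has constant term 2, so it
    cancels. *)
Lemma fps_sqrt_uniq (a : nat -> rat) p M : a 0%N = 1 -> p`_0 = 1 ->
  (forall m, (m < M)%N -> (p * p)`_m = a m) ->
  forall m, (m < M)%N -> p`_m = fps_sqrt a m.
Proof.
move=> a0 p0 pp m lt_m.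
pose r : {poly rat} := \poly_(i < M) fps_sqrt a i.
have r_m i : (i < M)%N -> r`_i = fps_sqrt a i by move=> lt_i; rewrite coef_poly lt_i.
rewrite -r_m //; apply: (@eqX_coef M) => //.
apply: (@eqX_cancel _ _ _ (p + r)).
  rewrite coefD p0 r_m ?fps_sqrt0 //; exact: leq_ltn_trans lt_m.
have -> : (p + r) * p = p * p + r * p by ring.
have -> : (p + r) * r = r * r + r * p by ring.
apply: eqXD (eqX_refl _ _); apply: coef_eqX => i lt_i.
rewrite pp // coefM -(fps_sqrtK a0) /fps_mul; apply: eq_bigr => j _.
by rewrite !r_m //; have := ltn_ord j; lia.
Qed.

Lemma little_schroederE n : (dpoly n)`_n = little_schroeder n.
Proof.
rewrite /little_schroeder; set a := fun k => _.
(* The quadratic equation of [D] has discriminant [(1 + 'X)^2 - 8 'X = 1 - 6 'X + 'X^2], of which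
   [s] is the root. *)
pose s : {poly rat} := 1 + 'X - 4%:R * ('X * dpoly n).
have s_m m : s`_m.+1 = (1 + 'X : {poly rat})`_m.+1 - 4%:R * (dpoly n)`_m.
  by rewrite coefB -polyC_natr coefCM coefXM.
have s0 : s`_0 = 1.
  by rewrite coefB -polyC_natr coefCM coefXM mulr0 subr0 coefD coef1 coefX addr0.
have a0 : a 0%N = 1.
  by rewrite /a !coefD coefN coefZ coef1 coefX coefXn /= mulr0 subr0 addr0.
rewrite -(@fps_sqrt_uniq a s n.+2) //; last first.
  move=> m; apply: eqX_coef.
  (* The difference between [s * s] and the discriminant is [8 * 'X] times that of the sides of
     [dpoly_eq]; the factor ['X] raises the precision to [n.+2]. *)
  have /eqX_mulX := eqX_sym (dpoly_eq n).
  move/(eqXMl (8%:R)); rewrite /eqX; congr (_ %| _).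
  by rewrite /s -mul_polyC polyC_natr; ring.
rewrite s_m opprB addrCA subrr addr0 mulrC mulKf //.
Qed.

(** * Expansion by powers of the Catalan series *)

(** In this ballot form the recurrence [catalan_power_coefS] is Pascal's rule. *)
Lemma catalan_power_coef_ballot i j :
  catalan_power_coef i j.+1 =
    ('C(2 * j + i + 1, j.+1))%:R - ('C(2 * j + i + 1, j))%:R.
Proof.
rewrite /catalan_power_coef andbF.
have -> : (2 * j.+1 + i = (2 * j + i + 1).+1)%N by lia.
have := mul_bin_diag (2 * j + i + 1).+1 j; have := mul_bin_left (2 * j + i + 1) j.
rewrite [_.+1.-1]/=; set m := (2 * j + i + 1)%N.
have -> : (m - j = j + i + 1)%N by rewrite /m; lia.
move=> /(congr1 (fun k => k%:R : rat)) E1 /(congr1 (fun k => k%:R : rat)) E2.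
rewrite !natrM in E1 E2.
have j0 : j.+1%:R != 0 :> rat by rewrite pnatr_eq0.
have m0 : m.+1%:R != 0 :> rat by rewrite pnatr_eq0.
apply: (mulfI j0); rewrite mulrCA -E2 mulrBr E1 mulrA divfK // !natrD -natr1.
by ring.
Qed.

Lemma catalan_power_coef0 i : catalan_power_coef i 0 = 1.
Proof.
rewrite /catalan_power_coef; case: i => //= i.
by rewrite add0n bin0 mulr1 divff // pnatr_eq0.
Qed.

Lemma catalan_power_coef0l j : catalan_power_coef 0 j = (j == 0%N)%:R.
Proof. by case: j => // j; rewrite /catalan_power_coef /= mul0r mul0r. Qed.

(** The coefficients of [C^(i+1) = C^i + s C^(i+2)], which is [C = 1 + s C^2] times [C^i]. *)
Lemma catalan_power_coefS i j : catalan_power_coef i.+1 j.+1 =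
  catalan_power_coef i j.+1 + catalan_power_coef i.+2 j.
Proof.
rewrite !catalan_power_coef_ballot; case: j => [|j].
  by rewrite catalan_power_coef0 !bin0 !bin1 !addnS !addn0 -natr1; ring.
rewrite catalan_power_coef_ballot.
have -> : (2 * j.+1 + i.+1 + 1 = (2 * j.+1 + i + 1).+1)%N by lia.
have -> : (2 * j + i.+2 + 1 = 2 * j.+1 + i + 1)%N by lia.
by rewrite !binS !natrD; ring.
Qed.

Lemma catalan_power_coef1 j : catalan_power_coef 1 j = catalan j.
Proof.
rewrite /catalan_power_coef /= mul1r /catalan.
have := mul_bin_down (2 * j + 1) j; rewrite addn1 [_.+1.-1]/=.
have -> : ((2 * j).+1 - j = j.+1)%N by lia.
move=> /(congr1 (fun k => k%:R : rat)); rewrite !natrM => E.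
have j0 : j.+1%:R != 0 :> rat by rewrite pnatr_eq0.
have m0 : (2 * j).+1%:R != 0 :> rat by rewrite pnatr_eq0.
by apply: (mulfI m0); rewrite mulrA divff // mul1r mulrA E mulrC mulKf.
Qed.

Section SecondFormula.
Variable n : nat.
Local Notation N := n.+1.
Local Notation "p === q" := (eqX N p q) (at level 70, no associativity).

Definition catalan_power i : {poly rat} :=
  \poly_(j < N) catalan_power_coef i j.

Lemma catalan_power0 : catalan_power 0 = 1.
Proof.
apply/polyP=> j; rewrite coef_poly coef1 catalan_power_coef0l.
by case: ltnP => //; case: j.
Qed.

Lemma catalan_powerS i :
  catalan_power i.+1 === catalan_power i + 'X * catalan_power i.+2.
Proof.
apply: coef_eqX => -[|j] lt_j; rewrite coefD coefXM !coef_poly lt_j.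
  by rewrite !catalan_power_coef0 addr0.
by rewrite catalan_power_coefS ltnW.
Qed.

(** The recurrence raises the index to [i.+2] but with a factor ['X], so an outer induction on the
    precision [M], for all indices, handles that term. *)
Lemma catalan_powerD i k :
  catalan_power i * catalan_power k === catalan_power (i + k).
Proof.
suff main M : (M <= N)%N -> forall i,
    eqX M (catalan_power i * catalan_power k) (catalan_power (i + k)) by exact: main.
elim: M => [|M IHM] le_M {}i; first by rewrite /eqX expr0 dvd1p.
elim: i => [|i IHi]; first by rewrite catalan_power0 mul1r; apply: eqX_refl.
have cS m := eqXW le_M (catalan_powerS m).
apply: eqX_trans (eqXM (cS i) (eqX_refl _ _)) _.
apply: eqX_trans (eqX_sym (cS (i + k)%N)).
rewrite mulrDl -mulrA; apply: eqXD IHi _; apply: eqX_mulX.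
by apply: IHM; exact: ltnW.
Qed.

Lemma catalan_powerX i : catalan_power 1 ^+ i === catalan_power i.
Proof.
elim: i => [|i IHi]; first by rewrite catalan_power0; apply: eqX_refl.
rewrite exprSr; apply: eqX_trans (eqXM IHi (eqX_refl _ _)) _.
by have := catalan_powerD i 1; rewrite addn1.
Qed.

Lemma catalan_equation s : 'X %| s ->
  (catalan_power 1 \Po s) === 1 + s * (catalan_power 1 \Po s) ^+ 2.
Proof.
move=> Xs; have E : catalan_power 1 === 1 + 'X * catalan_power 1 ^+ 2.
  apply: eqX_trans (catalan_powerS 0) _; rewrite catalan_power0.
  by apply: eqXD (eqX_refl _ _) _; apply: eqXMl; apply/eqX_sym/catalan_powerX.
have := eqX_comp E Xs.
by rewrite comp_polyD comp_polyM comp_polyX rmorphXn /= -[1]/(1%:P) comp_polyC.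
Qed.

(* This is the truncation of [(1 + 'X) ^- m.+1]. *)
Definition inv_power m : {poly rat} :=
  \poly_(k < N) ((-1) ^+ k * ('C(m + k, k))%:R).

Local Notation u := (inv_power 0).

Lemma inv_power0 : (1 + 'X) * u === 1.
Proof.
apply: coef_eqX => k lt_k; rewrite mulrDl mul1r coefD coefXM coef1 !coef_poly lt_k.
case: k lt_k => [|k] lt_k /=; first by rewrite bin0 mulr1 addr0.
by rewrite ltnW // !add0n !binn !mulr1 exprS mulN1r addNr.
Qed.

Lemma inv_powerS m : (1 + 'X) * inv_power m.+1 === inv_power m.
Proof.
apply: coef_eqX => k lt_k; rewrite mulrDl mul1r coefD coefXM !coef_poly lt_k.
case: k lt_k => [|k] lt_k /=; first by rewrite !bin0 addr0.
rewrite ltnW // !addSn !addnS binS exprS natrD; ring.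
Qed.

Lemma inv_powerE m : u ^+ m.+1 === inv_power m.
Proof.
elim: m => [|m IHm]; first exact: eqX_refl.
rewrite exprS; apply: eqX_trans (eqXMl _ IHm) _.
apply: eqX_trans (eqXMl _ (eqX_sym (inv_powerS m))) _.
rewrite mulrA -[X in eqX _ _ X]mul1r mulrC -[X in eqX _ _ X]mulrC.
by rewrite [u * _]mulrC; apply/eqXMl/inv_power0.
Qed.

(** The parameter [d] treats both series at once: [d = 1] gives [D], and [d = D] gives [L]. *)
Definition catalan_arg d := 2%:R * 'X * u ^+ 2 * d.

Lemma catalan_arg_dvd d : 'X %| catalan_arg d.
Proof. by rewrite /catalan_arg mulrAC mulrAC -mulrA mulrC mulrA dvdp_mull. Qed.

Definition quadratic_root d := u * (catalan_power 1 \Po catalan_arg d).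

Lemma quadratic_rootP d : (1 + 'X) * quadratic_root d ===
  1 + 'X * (2%:R * d) * quadratic_root d ^+ 2.
Proof.
rewrite /quadratic_root mulrA.
apply: eqX_trans (eqXM inv_power0 (eqX_refl _ _)) _; rewrite mul1r.
apply: eqX_trans (catalan_equation (catalan_arg_dvd d)) _.
have -> : 'X * (2%:R * d) * (u * (catalan_power 1 \Po catalan_arg d)) ^+ 2
   = catalan_arg d * (catalan_power 1 \Po catalan_arg d) ^+ 2.
  by rewrite {2}/catalan_arg; ring.
exact: eqX_refl.
Qed.

Lemma dpoly_catalan : dpoly n === quadratic_root 1.
Proof.
apply: (quadratic_uniq _ (quadratic_rootP 1)).
by have := dpoly_eq n; rewrite mulr1 ['X * _]mulrC.
Qed.

Lemma lpoly_catalan : lpoly n === quadratic_root (dpoly n).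
Proof.
apply: (quadratic_uniq _ (quadratic_rootP (dpoly n))).
have <- : 2%:R * 'X * dpoly n = 'X * (2%:R * dpoly n) by ring.
exact: lpoly_eq.
Qed.

Lemma comp_catalan_power i s : catalan_power i \Po s =
  \sum_(j < N) catalan_power_coef i j *: s ^+ j.
Proof.
rewrite /catalan_power poly_def raddf_sum /=; apply: eq_bigr => j _.
by rewrite comp_polyZ comp_Xn_poly.
Qed.

Lemma lpoly_sum : lpoly n === \sum_(i < N) \sum_(j < N)
  (catalan i * catalan_power_coef i j * 2%:R ^+ (i + j)) *:
  ('X^(i + j) * inv_power (3 * i + 2 * j)).
Proof.
apply: eqX_trans lpoly_catalan _; rewrite /quadratic_root comp_catalan_power mulr_sumr.
apply: eqX_sum => i; rewrite catalan_power_coef1.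
have pow_d : dpoly n ^+ i === u ^+ i * (catalan_power i \Po catalan_arg 1).
  apply: eqX_trans (eqX_exp i dpoly_catalan) _; rewrite exprMn; apply: eqXMl.
  rewrite -rmorphXn /=; apply: eqX_comp (catalan_powerX i) (catalan_arg_dvd 1).
have -> : u * (catalan i *: catalan_arg (dpoly n) ^+ i) =
    catalan i *: (u * (2%:R * 'X * u ^+ 2) ^+ i) * dpoly n ^+ i.
  by rewrite /catalan_arg -!mul_polyC exprMn; ring.
apply: eqX_trans (eqXMl _ pow_d) _.
rewrite comp_catalan_power !mulr_sumr; apply: eqX_sum => j.
(* The powers of [u] are 1 from the prefactor, [2 * i] from the outer argument, [i] from [D ^ i] and
   [2 * j] from the inner argument; [inv_power] absorbs the successor. *)
apply: eqX_trans (_ : eqX N _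
  ((catalan i * catalan_power_coef i j * 2%:R ^+ (i + j))%:P
   * ('X^(i + j) * u ^+ (3 * i + 2 * j).+1))) _; last first.
  by rewrite mul_polyC -!mul_polyC; do 2![apply: eqXMl]; apply: inv_powerE.
rewrite /eqX; set a := (X in X - _); set b := (X in _ - X).
suff -> : a = b by rewrite subrr dvdp0.
rewrite /a /b /catalan_arg -!mul_polyC !polyCM polyC_exp !polyC_natr.
rewrite mulr1 !exprMn exprS !exprD expr0; ring.
Qed.

Lemma coef_lpolyE : (lpoly n)`_n =
  \sum_(i < N) \sum_(j < N) \sum_(k < N | (i + j + k == n)%N)
      (-1) ^+ k * ('C(3 * i + 2 * j + k, k))%:R
      * catalan_power_coef i j * 2%:R ^+ (i + j) * catalan i.
Proof.
rewrite (eqX_coef lpoly_sum) // coef_sum; apply: eq_bigr => i _.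
rewrite coef_sum; apply: eq_bigr => j _.
rewrite coefZ coefXnM; case: ltnP => [lt|le].
  by rewrite mulr0 big_pred0 // => k; lia.
(* Only [k = n - (i + j)] satisfies the condition of the inner sum. *)
have lt_k : (n - (i + j) < N)%N by lia.
rewrite (big_pred1 (Ordinal lt_k)) => [|k]; last first.
  by apply/eqP/eqP => [E|->] /=; [apply: ord_inj => /= |]; lia.
by rewrite coef_poly lt_k /=; ring.
Qed.
End SecondFormula.

Theorem theorem3p5 (n : nat) :
  #|GNC n [:: [:: Up; Down]; [:: Level]]|%:R = little_schroeder n
  /\
  #|GNC n [:: [:: Down; Up]; [:: Level]]|%:R =
    \sum_(i < n.+1) \sum_(j < n.+1) \sum_(k < n.+1 | (i + j + k == n)%N)
      (-1) ^+ k * ('C(3 * i + 2 * j + k, k))%:R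
      * catalan_power_coef i j * 2%:R ^+ (i + j) * catalan i :> rat.
Proof.
split; first by rewrite card_GNC_ud -coef_dpoly little_schroederE.
by rewrite card_GNC_du -coef_lpoly coef_lpolyE.
Qed.
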